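(* Let $f:\mathbb{R}^n\to\mathbb{R}$ be continuously differentiable with $L$-Lipschitz continuous gradient ($L>0$), and suppose there is $f_{\rm low}\in\mathbb{R}$ with $f(\boldsymbol{x})\ge f_{\rm low}$ for all $\boldsymbol{x}\in\mathbb{R}^n$. Let $\eta,\sigma,P_{\max}>0$, $\kappa\in(0,1]$, $D_{\max}>1$, $p,q\in(0,1]$. Suppose that the random sequences $\{\mathcal{D}_k\}_k$ and $\{\boldsymbol{P}_k\}_k$ generated by the direct-search algorithm in reduced spaces are $(\kappa,D_{\max},p)$-descent and $(\eta,\sigma,P_{\max},q)$-well-aligned, respectively. Define $$\bar\alpha:=\frac{2\kappa\eta}{(L+c)P_{\max}^2D_{\max}^3},\quad \beta:=\frac{2D_{\max}^2(f(\boldsymbol{x}_0)-f_{\rm low})}{c\,\sigma^2},\quad \mu:=\log_{\gamma_{\rm inc}}(\gamma_{\rm dec}^{-1}),$$ $$C:=\frac{(\mu\gamma_{\rm dec}^2+\gamma_{\rm inc}^2)\gamma_{\rm inc}^2\beta}{\mu\gamma_{\rm dec}^4},\qquad p_0:=\max\left\{\frac{1}{1+\mu},\frac{\mu}{1+\mu}\right\},$$ and suppose $pq>p_0$. Let $0<\epsilon\le\min\left\{1,\frac{\gamma_{\rm inc}^{-1}\alpha_0}{\bar\alpha}\right\}$, and let $N_\epsilon$ be the number of function evaluations required by the algorithm to reach a point $\boldsymbol{x}_k$ such that $\|\nabla f(\boldsymbol{x}_k)\|\le\epsilon$. Then $$\mathbb{P}\left(N_\epsilon\le\left\lceil\frac{2m}{pq-p_0}\,\phi(\epsilon)\right\rceil\right)\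 \ge\ 1-\exp\left[-\frac{pq-p_0}{4pq}\,\phi(\epsilon)\right],$$ where $$\phi(\epsilon):=\frac{(1-p_0)C}{\bar\alpha^2}\epsilon^{-2}+(1-p_0)\log_{\gamma_{\rm dec}}\left(\frac{\gamma_{\rm dec}^2\bar\alpha}{\gamma_{\rm inc}\alpha_0}\epsilon\right).$$
   Context: $\|\cdot\|$ is the Euclidean norm for vectors and the operator 2-norm for matrices; $\log_a$ is the base-$a$ logarithm. Direct-search algorithm in reduced spaces. Inputs: $\boldsymbol{x}_0\in\mathbb{R}^n$, $\alpha_{\max}>0$, $\alpha_0\in(0,\alpha_{\max}]$, $c>0$, $0<\gamma_{\rm dec}<1<\gamma_{\rm inc}$, integers $m\ge1$ and $1\le r\le n$. For $k=0,1,\dots$: compute a matrix $\boldsymbol{P}_k\in\mathbb{R}^{r\times n}$ and a set $\mathcal{D}_k\subset\mathbb{R}^r$ of $m$ vectors. If there exists $\boldsymbol{d}_k\in\mathcal{D}_k$ such that $f(\boldsymbol{x}_k+\alpha_k\boldsymbol{P}_k^{\rm T}\boldsymbol{d}_k)<f(\boldsymbol{x}_k)-\frac c2\alpha_k^2\|\boldsymbol{P}_k^{\rm T}\boldsymbol{d}_k\|^2$, set $\boldsymbol{x}_{k+1}:=\boldsymbol{x}_k+\alpha_k\boldsymbol{P}_k^{\rm T}\boldsymbol{d}_k$ and $\alpha_{k+1}:=\min\{\gamma_{\rm inc}\alpha_k,\alpha_{\max}\}$. Otherwise set $\boldsymbol{x}_{k+1}:=\boldsymbol{x}_k$ and $\alpha_{k+1}:=\gamma_{\rm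 dec}\alpha_k$. Each iteration thus evaluates $f$ at no more than $m$ new points $\boldsymbol{x}_k+\alpha_k\boldsymbol{P}_k^{\rm T}\boldsymbol{d}$, $\boldsymbol{d}\in\mathcal{D}_k$. The matrices $\boldsymbol{P}_k$ and the sets $\mathcal{D}_k$ are random; they are the source of randomness in the algorithm. $\boldsymbol{P}_k$ is $(\eta,\sigma,P_{\max})$-well aligned (for $f$ at $\boldsymbol{x}_k$) if $\|\boldsymbol{P}_k\nabla f(\boldsymbol{x}_k)\|\ge\eta\|\nabla f(\boldsymbol{x}_k)\|$, $\|\boldsymbol{P}_k\|\le P_{\max}$ and $\sigma_{\min}(\boldsymbol{P}_k)\ge\sigma$, where $\sigma_{\min}(\boldsymbol{P}_k)$ denotes the minimum nonzero singular value of $\boldsymbol{P}_k$. $\mathcal{D}_k$ is $(\kappa,D_{\max})$-descent (for $f$ and $\boldsymbol{P}_k$ at $\boldsymbol{x}_k$) if $\max_{\boldsymbol{d}\in\mathcal{D}_k}\frac{-\boldsymbol{d}^{\rm T}\boldsymbol{P}_k\nabla f(\boldsymbol{x}_k)}{\|\boldsymbol{d}\|\,\|\boldsymbol{P}_k\nabla f(\boldsymbol{x}_k)\|}\ge\kappa$ and $D_{\max}^{-1}\le\|\boldsymbol{d}\|\le D_{\max}$ for all $\boldsymbol{d}\in\mathcal{D}_k$. Let $\mathcal{F}_{k-1}$ be the $\sigma$-algebra generated by $\boldsymbol{P}_0,\mathcal{D}_0,\dots,\boldsymbol{P}_{k-1},\mathcal{D}_{k-1}$ (trivial for $k=0$)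 and $\mathcal{F}_{k-1/2}$ the one generated by $\boldsymbol{P}_0,\mathcal{D}_0,\dots,\boldsymbol{P}_{k-1},\mathcal{D}_{k-1},\boldsymbol{P}_k$. The sequence $\{\boldsymbol{P}_k\}_k$ is $(\eta,\sigma,P_{\max},q)$-well-aligned if $\mathbb{P}(\boldsymbol{P}_k\text{ is }(\eta,\sigma,P_{\max})\text{-well aligned}\mid\mathcal{F}_{k-1})\ge q$ for all $k\ge0$. The sequence $\{\mathcal{D}_k\}_k$ is $(\kappa,D_{\max},p)$-descent if $\mathbb{P}(\mathcal{D}_k\text{ is }(\kappa,D_{\max})\text{-descent}\mid\mathcal{F}_{k-1/2})\ge p$ for all $k\ge0$.
   Formalization: Well-aligned is taken to require also that P_k has full row rank, so rank-deficient draws count as not well aligned; with the minimum over nonzero singular values alone, accepted steps P_k^T d can be arbitrarily short and the claim fails. *)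

(* Defs.v *)
From HB Require Import structures.
From mathcomp Require Import all_boot all_order all_algebra.
From mathcomp Require Import all_classical all_reals all_analysis.
Import Order.TTheory GRing.Theory Num.Theory numFieldNormedType.Exports.

Set Implicit Arguments.
Unset Strict Implicit.
Unset Printing Implicit Defensive.

Local Open Scope classical_set_scope.
Local Open Scope ring_scope.

(* The library norm on matrices is the sup norm, hence the two norms below;
   the topology (openness, continuity, differentiability) is the same. *)
Definition enorm (R : realType) (n : nat) (v : 'cV[R]_n) : R :=
  Num.sqrt (\sum_(i < n) v i 0 ^+ 2).

Definition opnorm (R : realType) (r n : nat) (M : 'M[R]_(r, n)) : R :=
  sup [set enorm (M *m v) | v in [set v : 'cV[R]_n | enorm v <= 1]].

Definition dotp (R : realType) (n : nat) (u v : 'cV[R]_n) : R :=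
  (u^T *m v) 0 0.

Definition logb (R : realType) (a y : R) : R := ln y / ln a.

Definition grad (R : realType) (n : nat) (f : 'cV[R]_n -> R) (x : 'cV[R]_n) :
    'cV[R]_n :=
  \col_(i < n) 'D_(delta_mx i 0) f x.

Definition singular_value (R : realType) (r n : nat) (M : 'M[R]_(r, n)) (s : R) :
    Prop :=
  0 <= s /\ eigenvalue (M^T *m M) (s ^+ 2).

Definition sigma_min (R : realType) (r n : nat) (M : 'M[R]_(r, n)) : R :=
  inf [set s | singular_value M s /\ s != 0].

(* Full row rank is explicit: the bound |M^T d| >= sigma |d|, for which the
   condition on sigma_min is imposed, fails for rank-deficient M (r <= n), since
   sigma_min ignores zero singular values. *)
Definition well_aligned (R : realType) (r n : nat) (eta sigma Pmax : R)
    (f : 'cV[R]_n -> R) (x : 'cV[R]_n) (M : 'M[R]_(r, n)) : Prop :=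
  [/\ eta * enorm (grad f x) <= enorm (M *m grad f x),
      opnorm M <= Pmax,
      row_free M &
      sigma <= sigma_min M].

(* -1 is a lower bound of all the cosines, so it is neutral for the maximum.
   When v = 0 the cosines are undefined; the usual convention is the value 1. *)
Definition cosine_measure (R : realType) (r m : nat) (D : 'I_m -> 'cV[R]_r)
    (v : 'cV[R]_r) : R :=
  if v == 0 then 1
  else \big[Order.max/(-1)]_(i < m) (dotp (D i) v / (enorm (D i) * enorm v)).

Definition descent_set (R : realType) (r n m : nat) (kappa Dmax : R)
    (f : 'cV[R]_n -> R) (x : 'cV[R]_n) (M : 'M[R]_(r, n))
    (D : 'I_m -> 'cV[R]_r) : Prop :=
  kappa <= cosine_measure D (- (M *m grad f x)) /\
  forall i, Dmax^-1 <= enorm (D i) <= Dmax.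

Definition sufficient_decrease (R : realType) (n : nat) (f : 'cV[R]_n -> R)
    (c : R) (x : 'cV[R]_n) (a : R) (s : 'cV[R]_n) : Prop :=
  f (x + a *: s) < f x - c / 2 * a ^+ 2 * enorm s ^+ 2.

(* One run of the algorithm. [E k] is the set of (indices of) directions of
   [D k] at which f is evaluated in iteration k: it contains the accepted
   direction, and is everything when the iteration is unsuccessful. Which
   directions are polled, and which decreasing one is accepted, is left free. *)
Definition direct_search (R : realType) (r n m : nat) (f : 'cV[R]_n -> R)
    (x0 : 'cV[R]_n) (alpha0 alphamax c gdec ginc : R)
    (P : nat -> 'M[R]_(r, n)) (D : nat -> 'I_m -> 'cV[R]_r)
    (x : nat -> 'cV[R]_n) (alpha : nat -> R) (E : nat -> {set 'I_m}) : Prop :=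
  [/\ x 0%N = x0,
      alpha 0%N = alpha0 &
      forall k,
        (exists i, [/\ i \in E k,
             sufficient_decrease f c (x k) (alpha k) ((P k)^T *m D k i),
             x k.+1 = x k + alpha k *: ((P k)^T *m D k i) &
             alpha k.+1 = Order.min (ginc * alpha k) alphamax]) \/
        [/\ forall i,
             ~ sufficient_decrease f c (x k) (alpha k) ((P k)^T *m D k i),
            E k = [set: 'I_m]%SET,
            x k.+1 = x k &
            alpha k.+1 = gdec * alpha k]].

(* The leading 1 is the evaluation f(x_0). The infimum is attained at the first
   k with a small gradient, and is +oo if there is none. *)
Definition Neval (R : realType) (n m : nat) (f : 'cV[R]_n -> R)
    (x : nat -> 'cV[R]_n) (E : nat -> {set 'I_m}) (eps : R) : \bar R :=
  ereal_inf [set ((1 + \sum_(j < k) #|E j|)%N%:R)%:E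
            | k in [set k | enorm (grad f (x k)) <= eps]].

Definition preimages (T : Type) (V : topologicalType) (X : T -> V) :
    set (set T) :=
  [set X @^-1` U | U in [set U : set V | open U]].

Definition adapted (T : Type) (V : topologicalType) (G : set (set T))
    (X : T -> V) : Prop :=
  preimages X `<=` G.

(* [hist P D k] is generated by P_0, D_0, ..., P_(k-1), D_(k-1), and
   [hist_half P D k] by these and P_k. *)
Definition hist_gen (T : Type) (R : realType) (r n m : nat)
    (P : nat -> T -> 'M[R]_(r, n)) (D : nat -> T -> 'I_m -> 'cV[R]_r) (k : nat) :
    set (set T) :=
  \bigcup_(j in `I_k)
    (preimages (P j) `|` \bigcup_(i in [set: 'I_m]) preimages (D j ^~ i)).

Definition hist (T : Type) (R : realType) (r n m : nat)
    (P : nat -> T -> 'M[R]_(r, n)) (D : nat -> T -> 'I_m -> 'cV[R]_r) (k : nat) :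
    set (set T) :=
  <<s hist_gen P D k >>.

Definition hist_half (T : Type) (R : realType) (r n m : nat)
    (P : nat -> T -> 'M[R]_(r, n)) (D : nat -> T -> 'I_m -> 'cV[R]_r) (k : nat) :
    set (set T) :=
  <<s hist_gen P D k `|` preimages (P k) >>.

Definition is_cond_prob (d : measure_display) (T : measurableType d)
    (R : realType) (Pr : probability T R) (G : set (set T)) (A : set T)
    (Z : T -> R) : Prop :=
  [/\ adapted G Z,
      Pr.-integrable [set: T] (EFin \o Z) &
      forall B, G B -> (\int[Pr]_(w in B) (Z w)%:E = Pr (A `&` B))%E].

(* Pr(A | G) >= q almost surely; versions of Pr(A | G) agree almost surely. *)
Definition cond_prob_ge (d : measure_display) (T : measurableType d)
    (R : realType) (Pr : probability T R) (G : set (set T)) (A : set T)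
    (q : R) : Prop :=
  exists2 Z : T -> R, is_cond_prob Pr G A Z & {ae Pr, forall w, q <= Z w}.

Definition well_aligned_seq (d : measure_display) (T : measurableType d)
    (R : realType) (Pr : probability T R) (r n m : nat) (eta sigma Pmax q : R)
    (f : 'cV[R]_n -> R) (x : nat -> T -> 'cV[R]_n)
    (P : nat -> T -> 'M[R]_(r, n)) (D : nat -> T -> 'I_m -> 'cV[R]_r) : Prop :=
  forall k, cond_prob_ge Pr (hist P D k)
    [set w | well_aligned eta sigma Pmax f (x k w) (P k w)] q.

Definition descent_seq (d : measure_display) (T : measurableType d)
    (R : realType) (Pr : probability T R) (r n m : nat) (kappa Dmax p : R)
    (f : 'cV[R]_n -> R) (x : nat -> T -> 'cV[R]_n)
    (P : nat -> T -> 'M[R]_(r, n)) (D : nat -> T -> 'I_m -> 'cV[R]_r) : Prop :=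
  forall k, cond_prob_ge Pr (hist_half P D k)
    [set w | descent_set kappa Dmax f (x k w) (P k w) (D k w)] p.

(* The algorithm run on random matrices and sets of directions. These are the
   only source of randomness: x_k, and the directions polled at iteration k,
   depend only on what has been drawn so far. *)
Definition random_direct_search (d : measure_display) (T : measurableType d)
    (R : realType) (r n m : nat) (f : 'cV[R]_n -> R)
    (x0 : 'cV[R]_n) (alpha0 alphamax c gdec ginc : R)
    (P : nat -> T -> 'M[R]_(r, n)) (D : nat -> T -> 'I_m -> 'cV[R]_r)
    (x : nat -> T -> 'cV[R]_n) (alpha : nat -> T -> R)
    (E : nat -> T -> {set 'I_m}) : Prop :=
  [/\ forall k, adapted (@measurable d T) (P k),
      forall k i, adapted (@measurable d T) (D k ^~ i),
      forall k, adapted (hist P D k) (x k),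
      forall k A, hist P D k.+1 [set w | E k w = A] &
      forall w, direct_search f x0 alpha0 alphamax c gdec ginc
        (P ^~ w) (D ^~ w) (x ^~ w) (alpha ^~ w) (E ^~ w)].

(* Main.v *)
Require Import Defs.
From mathcomp Require Import all_boot all_order all_algebra.
From mathcomp Require Import ring lra.
From mathcomp Require Import all_classical all_reals all_analysis.
From mathcomp Require Import measurable_realfun.
Import Order.TTheory GRing.Theory Num.Theory numFieldNormedType.Exports.

Set Implicit Arguments.
Unset Strict Implicit.
Unset Printing Implicit Defensive.

Local Open Scope classical_set_scope.
Local Open Scope ring_scope.

(** Call an iteration good when [P_k] is well aligned and [D_k] is descent. The
    proof bounds the number of good iterations in two incompatible ways.

    As long as the gradient norm exceeds [eps], good iterations are a bounded
    fraction of all iterations, on every run ([good_iterations_le]). By the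
    quadratic upper model of [f] ([descent_lemma]), a good iteration whose step
    is below [a = abar * eps] succeeds ([small_step_success]), and a success at
    a good iteration whose step is of order [a] or more decreases [f] by a fixed
    amount, which can happen only finitely often as [f] is bounded below. The
    remaining good iterations are failures with large steps and successes with
    small steps. In logarithmic scale, failures move the step size down by
    [mu] units and successes move it up by at most one unit, so that these two
    kinds can only be numerous if there are enough moves in the opposite
    direction, and beyond the decreases already counted these are moves of
    iterations that are not good. The bookkeeping is a single induction
    with a potential of the step size ([step_potential], [good_le_bad]), and
    yields [#good <= max mu mu^-1 * #bad + const], that is,
    [#good <= p0 * k + phi] among the first [k] iterations.

    On the other hand, conditionally on the past an iteration is good with
    probability at least [p * q] ([good_iteration_prob]), so a Chernoff bound
    ([chernoff_count]) makes it exponentially unlikely that only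
    [(p0 + p q) / 2 * k] of the first [k] iterations are good. Since
    [p0 < p * q], for [k >= 2 phi / (p q - p0)] the first bound forces this
    unlikely event unless a gradient norm of at most [eps] has been reached, and
    [k] iterations cost at most [m * k] evaluations.

    Two points need more than bookkeeping. The decrease of [f] requires
    [sigma |d| <= |P^T d|], whereas the hypothesis is about the smallest nonzero
    singular value; the passage ([sigma_min_geP]) uses that the least
    eigenvalue of [P P^T] minimizes its Rayleigh quotient. And every event in
    play must be measurable for the right sub-sigma-algebra, which is obtained
    by proving measurability on an arbitrary measurable type and instantiating
    it at the generated sigma-algebras. *)

(** * Euclidean geometry and singular values *)

Section Euclidean.
Context {R : realType}.
Implicit Types n r : nat.

Lemma dotpE n (u v : 'cV[R]_n) : dotp u v = \sum_i u i 0 * v i 0.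
Proof. by rewrite /dotp mxE; apply: eq_bigr => i _; rewrite mxE. Qed.

Lemma dotpC n (u v : 'cV[R]_n) : dotp u v = dotp v u.
Proof. by rewrite !dotpE; apply: eq_bigr => i _; rewrite mulrC. Qed.

Lemma dotpDr n (u v w : 'cV[R]_n) : dotp u (v + w) = dotp u v + dotp u w.
Proof. by rewrite /dotp mulmxDr mxE. Qed.

Lemma dotpDl n (u v w : 'cV[R]_n) : dotp (v + w) u = dotp v u + dotp w u.
Proof. by rewrite dotpC dotpDr !(dotpC u). Qed.

Lemma dotpZr n a (u v : 'cV[R]_n) : dotp u (a *: v) = a * dotp u v.
Proof. by rewrite /dotp -scalemxAr mxE. Qed.

Lemma dotpZl n a (u v : 'cV[R]_n) : dotp (a *: u) v = a * dotp u v.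
Proof. by rewrite dotpC dotpZr dotpC. Qed.

Lemma dotp0r n (u : 'cV[R]_n) : dotp u 0 = 0.
Proof. by rewrite -(scale0r (0 : 'cV[R]_n)) dotpZr mul0r. Qed.

Lemma dotpNr n (u v : 'cV[R]_n) : dotp u (- v) = - dotp u v.
Proof. by rewrite -scaleN1r dotpZr mulN1r. Qed.

Lemma dotpNl n (u v : 'cV[R]_n) : dotp (- u) v = - dotp u v.
Proof. by rewrite dotpC dotpNr dotpC. Qed.

Lemma dotp_mulmx n r (M : 'M[R]_(r, n)) u v :
  dotp u (M *m v) = dotp (M^T *m u) v.
Proof. by rewrite /dotp trmx_mul trmxK mulmxA. Qed.

Lemma dotp_ge0 n (u : 'cV[R]_n) : 0 <= dotp u u.
Proof. by rewrite dotpE sumr_ge0 // => i _; rewrite -expr2 sqr_ge0. Qed.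

Lemma enorm_ge0 n (u : 'cV[R]_n) : 0 <= enorm u.
Proof. exact: sqrtr_ge0. Qed.

Lemma enorm_sqr n (u : 'cV[R]_n) : enorm u ^+ 2 = dotp u u.
Proof.
rewrite /enorm sqr_sqrtr; last by rewrite sumr_ge0 // => i _; rewrite sqr_ge0.
by rewrite dotpE; apply: eq_bigr => i _; rewrite expr2.
Qed.

Lemma enormZ n a (u : 'cV[R]_n) : enorm (a *: u) = `|a| * enorm u.
Proof.
apply/eqP; rewrite -(eqrXn2 (isT : 0 < 2)%N) ?mulr_ge0 ?enorm_ge0 //.
by rewrite exprMn !enorm_sqr dotpZl dotpZr real_normK ?num_real // mulrA expr2.
Qed.

Lemma enorm0 n : enorm (0 : 'cV[R]_n) = 0.
Proof. by rewrite -(scale0r (0 : 'cV[R]_n)) enormZ normr0 mul0r. Qed.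

Lemma enormN n (u : 'cV[R]_n) : enorm (- u) = enorm u.
Proof. by rewrite -scaleN1r enormZ normrN1 mul1r. Qed.

Lemma enorm_eq0 n (u : 'cV[R]_n) : (enorm u == 0) = (u == 0).
Proof.
apply/idP/idP => [|/eqP ->]; last first.
  by rewrite enorm0.
rewrite sqrtr_eq0 => u_le0; apply/eqP/matrixP => i j; rewrite ord1 mxE.
apply/eqP; rewrite -sqrf_eq0 eq_le sqr_ge0 andbT.
apply: le_trans u_le0; rewrite (bigD1 i) //= lerDl.
by rewrite sumr_ge0 // => k _; rewrite sqr_ge0.
Qed.

Lemma enorm_gt0 n (u : 'cV[R]_n) : (0 < enorm u) = (u != 0).
Proof. by rewrite lt_def enorm_ge0 andbT enorm_eq0. Qed.

(** Cauchy-Schwarz for a possibly degenerate form, because it serves both for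
    the Euclidean inner product and, in [psd_inv_coercive], for a matrix that
    is only known to be positive semidefinite. *)
Lemma psd_cauchy_schwarz n (Q : 'M[R]_n) (x y : 'cV[R]_n) :
  Q^T = Q -> (forall z : 'cV[R]_n, 0 <= dotp z (Q *m z)) ->
  dotp x (Q *m y) ^+ 2 <= dotp x (Q *m x) * dotp y (Q *m y).
Proof.
move=> Qsym Qpsd.
set a := dotp x (Q *m x); set b := dotp x (Q *m y); set c := dotp y (Q *m y).
have bC : dotp y (Q *m x) = b by rewrite dotp_mulmx Qsym dotpC.
have quad s t : 0 <= s ^+ 2 * a + 2 * (s * t * b) + t ^+ 2 * c.
  have := Qpsd (s *: x + t *: y).
  rewrite mulmxDr -!scalemxAr !dotpDl !dotpDr !dotpZl !dotpZr bC -/a -/b -/c.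
  by congr (0 <= _); ring.
have a0 : 0 <= a := Qpsd x.
(* If c = 0, the form is affine in t, and t = - (a + 1) at s = b shows b = 0. *)
have /orP[/eqP c0|c0] : (c == 0) || (0 < c) by rewrite eq_sym -le_eqVlt Qpsd.
  have := quad b (- (a + 1)); rewrite c0 mulr0.
  have : 0 <= b ^+ 2 * a by rewrite mulr_ge0 ?sqr_ge0.
  have := sqr_ge0 b; nra.
have : 0 <= c * (a * c - b ^+ 2).
  by have := quad c (- b); congr (0 <= _); ring.
by rewrite pmulr_rge0 // subr_ge0.
Qed.

Lemma cauchy_schwarz n (u v : 'cV[R]_n) : `|dotp u v| <= enorm u * enorm v.
Proof.
rewrite -(ler_pXn2r (isT : 0 < 2)%N) ?nnegrE ?mulr_ge0 ?enorm_ge0 //.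
rewrite real_normK ?num_real // exprMn !enorm_sqr.
have := @psd_cauchy_schwarz n 1%:M u v; rewrite !mul1mx; apply.
  exact: trmx1.
by move=> z; rewrite mul1mx dotp_ge0.
Qed.

Lemma dotp_le n (u v : 'cV[R]_n) : dotp u v <= enorm u * enorm v.
Proof. exact: le_trans (ler_norm _) (cauchy_schwarz _ _). Qed.

Lemma enorm_mulmx_bounded r n (M : 'M[R]_(r, n)) :
  exists2 K, 0 < K & forall v : 'cV[R]_n, enorm (M *m v) <= K * enorm v.
Proof.
pose S := \sum_i enorm (row i M)^T ^+ 2.
have S0 : 0 <= S by rewrite sumr_ge0 // => i _; rewrite sqr_ge0.
exists (Num.sqrt S + 1) => [|v]; first by rewrite ltr_wpDl ?sqrtr_ge0.
apply: (@le_trans _ _ (Num.sqrt S * enorm v)); last first.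
  by rewrite ler_wpM2r ?enorm_ge0 // lerDl.
rewrite -(ler_pXn2r (isT : 0 < 2)%N) ?nnegrE ?mulr_ge0 ?enorm_ge0 ?sqrtr_ge0 //.
rewrite exprMn [Num.sqrt S ^+ 2]sqr_sqrtr // [leLHS]enorm_sqr dotpE mulr_suml.
rewrite ler_sum // => i _.
have -> : (M *m v) i 0 = dotp (row i M)^T v.
  by rewrite dotpE mxE; apply: eq_bigr => j _; rewrite !mxE.
rewrite -expr2 -exprMn -[leLHS]real_normK ?num_real //.
by rewrite ler_pXn2r ?nnegrE ?mulr_ge0 ?enorm_ge0 ?cauchy_schwarz.
Qed.

Lemma opnorm_leP r n (M : 'M[R]_(r, n)) (K : R) : 0 <= K ->
  opnorm M <= K <-> forall v : 'cV[R]_n, enorm (M *m v) <= K * enorm v.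
Proof.
move=> K0; split => [MK v|MK]; last first.
  apply: ge_sup; first by exists 0; exists 0; rewrite /= ?mulmx0 ?enorm0.
  by move=> _ [v /= v1 <-]; rewrite (le_trans (MK v)) // ler_piMr.
have [->|v0] := eqVneq v 0.
  by rewrite mulmx0 !enorm0 mulr0.
have v_gt0 : 0 < enorm v by rewrite enorm_gt0.
have nv1 : enorm ((enorm v)^-1 *: v) <= 1.
  by rewrite enormZ gtr0_norm ?invr_gt0 // mulVf ?gt_eqF.
rewrite mulrC -ler_pdivrMl // -[(enorm v)^-1]gtr0_norm ?invr_gt0 // -enormZ.
rewrite scalemxAr; apply: le_trans MK; rewrite /opnorm.
apply: (@ub_le_sup R); last by exists ((enorm v)^-1 *: v).
have [K' K'0 hK'] := enorm_mulmx_bounded M.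
by exists K' => _ [w /= w1 <-]; apply: le_trans (hK' w) _; rewrite ler_piMr ?(ltW K'0).
Qed.

(** [M] and [M^T] have the same norm, since
    [|M^T u|^2 = <u, M M^T u> <= |u| K |M^T u|]. *)
Lemma opnorm_trmx_le r n (M : 'M[R]_(r, n)) (K : R) (u : 'cV[R]_r) :
  0 <= K -> opnorm M <= K -> enorm (M^T *m u) <= K * enorm u.
Proof.
move=> K0 /(opnorm_leP _ K0) MK; set w := M^T *m u.
have [->|w0] := eqVneq w 0.
  by rewrite enorm0 mulr_ge0 ?enorm_ge0.
rewrite -(ler_pM2r (_ : 0 < enorm w)) ?enorm_gt0 //.
rewrite -expr2 enorm_sqr {1}/w -dotp_mulmx.
apply: le_trans (dotp_le _ _) _; rewrite mulrAC mulrC.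
by rewrite ler_wpM2r ?enorm_ge0 ?MK.
Qed.

(** Cauchy-Schwarz for the form of [Q], at [x] and [Q x], gives
    [|Q x|^2 <= |Q| <x, Q x>], and [|x| <= |Q^-1| |Q x|]. *)
Lemma psd_inv_coercive n (Q : 'M[R]_n) :
  Q^T = Q -> (forall z : 'cV[R]_n, 0 <= dotp z (Q *m z)) -> Q \in unitmx ->
  exists2 e, 0 < e & forall z : 'cV[R]_n, e * enorm z ^+ 2 <= dotp z (Q *m z).
Proof.
move=> Qsym Qpsd Qinv.
have [K K0 hK] := enorm_mulmx_bounded Q.
have [K' K'0 hK'] := enorm_mulmx_bounded (invmx Q).
exists (K * K' ^+ 2)^-1 => [|z]; first by rewrite invr_gt0 mulr_gt0 ?exprn_gt0.
set w := Q *m z; set s := dotp z w.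
suff w_le : enorm w ^+ 2 <= K * s.
  rewrite mulrC ler_pdivrMr ?mulr_gt0 ?exprn_gt0 //.
  have -> : s * (K * K' ^+ 2) = K' ^+ 2 * (K * s) by ring.
  apply: le_trans (_ : K' ^+ 2 * enorm w ^+ 2 <= _); last first.
    by rewrite ler_wpM2l ?sqr_ge0.
  rewrite -exprMn ler_pXn2r ?nnegrE ?mulr_ge0 ?enorm_ge0 ?(ltW K'0) //.
  by have := hK' w; rewrite /w mulmxA mulVmx // mul1mx.
have s0 : 0 <= s by exact: Qpsd.
have [->|w0] := eqVneq w 0.
  by rewrite enorm0 expr0n mulr_ge0 ?(ltW K0).
have nw0 : 0 < enorm w ^+ 2 by rewrite exprn_gt0 ?enorm_gt0.
rewrite -(ler_pM2r nw0) -expr2.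
have := psd_cauchy_schwarz z w Qsym Qpsd.
rewrite [dotp z (Q *m w)]dotp_mulmx Qsym -enorm_sqr.
move=> h; apply: le_trans h _; rewrite -/w -/s.
have -> : K * s * enorm w ^+ 2 = s * (enorm w * (K * enorm w)) by ring.
rewrite ler_wpM2l //; apply: le_trans (dotp_le _ _) _.
by rewrite ler_wpM2l ?enorm_ge0.
Qed.

(** The largest [l] with [l |x|^2 <= |M^T x|^2] for all [x] makes
    [M M^T - l] positive semidefinite but, by [psd_inv_coercive], not
    invertible: it is the least eigenvalue of [M M^T], and it is nonzero when
    [M] has full row rank. *)
Lemma sigma_min_attained r n (M : 'M[R]_(r.+1, n)) : row_free M ->
  exists2 s, singular_value M s /\ s != 0 &
    forall u : 'cV[R]_r.+1, s * enorm u <= enorm (M^T *m u).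
Proof.
move=> Mfree.
pose E := [set l : R | forall u : 'cV[R]_r.+1,
  l * enorm u ^+ 2 <= enorm (M^T *m u) ^+ 2].
have E0 : E 0 by move=> u; rewrite mul0r sqr_ge0.
pose e0 : 'cV[R]_r.+1 := delta_mx 0 0.
have e0_neq0 : e0 != 0.
  apply/eqP => /matrixP /(_ 0 0); rewrite !mxE !eqxx /= => /eqP.
  by rewrite oner_eq0.
have ne0 : 0 < enorm e0 ^+ 2 by rewrite exprn_gt0 ?enorm_gt0.
have Eub : has_ubound E.
  exists (enorm (M^T *m e0) ^+ 2 / enorm e0 ^+ 2) => l /(_ e0).
  by rewrite ler_pdivlMr.
set l := sup E.
have El : E l.
  move=> u; have [->|u0] := eqVneq u 0.
    by rewrite mulmx0 !enorm0 expr0n mulr0.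
  have nu0 : 0 < enorm u ^+ 2 by rewrite exprn_gt0 ?enorm_gt0.
  rewrite -ler_pdivlMr //; apply: (@ge_sup R); first by exists 0.
  by move=> l' /(_ u); rewrite ler_pdivlMr.
have l0 : 0 <= l by apply: (@ub_le_sup R).
pose Q := M *m M^T - l%:M.
have QE u : dotp u (Q *m u) = enorm (M^T *m u) ^+ 2 - l * enorm u ^+ 2.
  by rewrite mulmxBl mul_scalar_mx dotpDr dotpNr dotpZr -mulmxA dotp_mulmx
             !enorm_sqr.
have Qsym : Q^T = Q by rewrite linearB /= trmx_mul trmxK tr_scalar_mx.
have Qpsd u : 0 <= dotp u (Q *m u) by rewrite QE subr_ge0.
have Qsing : Q \notin unitmx.
  apply/negP => /(psd_inv_coercive Qsym Qpsd)[e e_gt0 he].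
  suff : l + e <= l by rewrite gerDl leNgt e_gt0.
  apply: (@ub_le_sup R) => // u; rewrite mulrDl -lerBrDl.
  by rewrite -QE.
have [y y0 Qy] : exists2 y : 'cV[R]_r.+1, y != 0 & Q *m y = 0.
  move: Qsing; rewrite -row_free_unit -kermx_eq0 => /rowV0Pn[v vker v0].
  exists v^T; first by rewrite -trmx_eq0 trmxK.
  by apply: trmx_inj; rewrite trmx_mul trmxK Qsym trmx0; apply/sub_kermxP.
have SE : M *m M^T *m y = l *: y.
  by apply/eqP; rewrite -subr_eq0 -mul_scalar_mx -mulmxBl Qy.
pose w := M^T *m y.
have w0 : w != 0.
  apply: contraNneq y0 => wz; rewrite -trmx_eq0; apply/eqP.
  apply: (row_free_inj Mfree); rewrite mul0mx.
  by apply: trmx_inj; rewrite trmx_mul trmxK trmx0.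
have l_neq0 : l != 0.
  apply: contraNneq w0 => lz; rewrite -enorm_eq0 -sqrf_eq0 enorm_sqr /w.
  by rewrite -dotp_mulmx mulmxA SE lz scale0r dotp0r.
exists (Num.sqrt l) => [|u].
  split; last by rewrite sqrtr_eq0 -ltNge lt_def l_neq0.
  split; first exact: sqrtr_ge0.
  rewrite sqr_sqrtr //; apply/eigenvalueP; exists w^T; last by rewrite trmx_eq0.
  apply: trmx_inj; rewrite linearZ /= trmx_mul !trmxK trmx_mul trmxK.
  by rewrite /w -mulmxA [M *m _]mulmxA SE scalemxAr.
rewrite -(ler_pXn2r (isT : 0 < 2)%N) ?nnegrE ?mulr_ge0 ?enorm_ge0 ?sqrtr_ge0 //.
by rewrite exprMn [Num.sqrt l ^+ 2]sqr_sqrtr.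
Qed.

(** This form of the condition on [sigma_min] is the one that the analysis of
    a step uses, and it is visibly closed in [M]. From right to left: a nonzero
    singular value [t] has a left singular vector [u = M v], for which
    [|M^T u| = t |u|]. *)
Lemma sigma_min_geP r n (M : 'M[R]_(r.+1, n)) (s : R) : 0 < s ->
  (row_free M /\ s <= sigma_min M) <->
  forall u : 'cV[R]_r.+1, s * enorm u <= enorm (M^T *m u).
Proof.
have lb0 : has_lbound [set t | singular_value M t /\ t != 0].
  by exists 0 => t [[]].
move=> s0; split => [[/sigma_min_attained[t Mt ht] sM] u|hs].
  apply: le_trans (ht u); rewrite ler_wpM2r ?enorm_ge0 //.
  by apply: le_trans sM _; apply: (@ge_inf R).
have Mfree : row_free M.
  rewrite -kermx_eq0; apply/negPn/negP => /rowV0Pn[v vker]; rewrite -trmx_eq0.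
  rewrite -enorm_gt0 => v0; have := hs v^T.
  rewrite -trmx_mul (sub_kermxP vker) trmx0 enorm0 leNgt.
  by rewrite mulr_gt0.
split=> //; apply: (@lb_le_inf R).
  by have [t Mt _] := sigma_min_attained Mfree; exists t.
move=> t [[t0 /eigenvalueP[v vE v0]] tn0].
pose w := v^T; have wE : M^T *m M *m w = t ^+ 2 *: w.
  by apply: trmx_inj; rewrite linearZ /= /w trmx_mul !trmxK trmx_mul trmxK vE.
pose u := M *m w.
have w0 : w != 0 by rewrite trmx_eq0.
have uE : enorm (M^T *m u) = t ^+ 2 * enorm w.
  by rewrite /u mulmxA wE enormZ ger0_norm ?sqr_ge0.
have u2 : enorm u = t * enorm w.
  apply/eqP; rewrite -(eqrXn2 (isT : 0 < 2)%N) ?mulr_ge0 ?enorm_ge0 //.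
  by rewrite exprMn !enorm_sqr {2}/u dotp_mulmx /u mulmxA wE dotpZl.
have := hs u; rewrite uE u2 mulrA expr2 ler_pM2r ?enorm_gt0 //.
by rewrite ler_pM2r // lt_def tn0.
Qed.
End Euclidean.

(** * Steps of the algorithm on a smooth objective *)

Section Smoothness.
Context {R : realType}.

Lemma derive_dotp_grad n (f : 'cV[R]_n -> R) (x s : 'cV[R]_n) :
  differentiable f x -> 'D_s f x = dotp (grad f x) s.
Proof.
move=> df; rewrite deriveE // {1}[s]matrix_sum_delta raddf_sum dotpE.
apply: eq_bigr => i _; rewrite big_ord1 /= linearZ mxE deriveE //=.
by rewrite mulrC.
Qed.

Lemma is_derive_line n (f : 'cV[R]_n -> R) (x s : 'cV[R]_n) (t : R) :
  differentiable f (x + t *: s) ->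
  is_derive t 1 (fun u : R => f (x + u *: s)) (dotp (grad f (x + t *: s)) s).
Proof.
move=> df; rewrite -derive_dotp_grad //.
have quot : (fun h : R => h^-1 *: (f (x + (h *: 1 + t) *: s) - f (x + t *: s)))
  = (fun h : R => h^-1 *: (f (h *: s + (x + t *: s)) - f (x + t *: s))).
  apply/funext => h; congr (_ *: (f _ - _)).
  by rewrite scalerDl addrCA [h *: 1]mulr1.
apply: DeriveDef; rewrite /derivable /derive /= /shift /= quot //.
exact: diff_derivable.
Qed.

(** The fundamental inequality for functions with a Lipschitz gradient: along
    the segment, [f] minus its quadratic upper model has derivative at most
    zero. *)
Lemma descent_lemma n (f : 'cV[R]_n -> R) (L : R) (x s : 'cV[R]_n) :
  (forall y, differentiable f y) ->
  (forall y z, enorm (grad f y - grad f z) <= L * enorm (y - z)) ->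
  f (x + s) <= f x + dotp (grad f x) s + L / 2 * enorm s ^+ 2.
Proof.
move=> df f_lip; set g := dotp (grad f x) s; set N := enorm s ^+ 2.
pose psi (t : R) := f (x + t *: s) - (g * t + L / 2 * N * (t * t)).
pose dpsi (t : R) := dotp (grad f (x + t *: s)) s - (g + L * N * t).
have psiD (t : R) : is_derive t 1 psi (dpsi t).
  have D1 := is_derive_line (df (x + t *: s)).
  apply: is_derive_eq; rewrite /dpsi /GRing.scale /= !mulr1.
  by congr (_ - (_ + _)); field.
have psi_cont : {within `[0, 1], continuous psi}.
  apply: continuous_subspaceT => t.
  by apply/differentiable_continuous/derivable1_diffP; case: (psiD t).
have [c /[!in_itv] /= /andP[c0 _] cE] := MVT ltr01 (fun t _ => psiD t) psi_cont.
suff dpsi_le0 : dpsi c <= 0.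
  have : psi 1 - psi 0 <= 0 by rewrite cE subr0 mulr1.
  rewrite /psi scale1r scale0r addr0 !mulr1 !mulr0 addr0 subr0.
  by rewrite subr_le0 lerBlDr addrA addrAC mulrAC; lra.
rewrite /dpsi opprD addrA subr_le0.
have -> : dotp (grad f (x + c *: s)) s - g
          = dotp (grad f (x + c *: s) - grad f x) s.
  by rewrite dotpDl dotpNl.
apply: le_trans (dotp_le _ _) _.
have := f_lip (x + c *: s) x; rewrite addrAC subrr add0r enormZ gtr0_norm // => h.
apply: (@le_trans _ _ (L * (c * enorm s) * enorm s)).
  by rewrite ler_wpM2r ?enorm_ge0.
by rewrite /N le_eqVlt; apply/orP; left; apply/eqP; ring.
Qed.

Section Iteration.
Variables (n r m : nat) (f : 'cV[R]_n -> R) (L c : R).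
Variables (eta sigma Pmax kappa Dmax : R).
Hypotheses (df : forall y, differentiable f y) (L_gt0 : 0 < L) (c_gt0 : 0 < c).
Hypothesis f_lip :
  forall y z, enorm (grad f y - grad f z) <= L * enorm (y - z).
Hypotheses (eta_gt0 : 0 < eta) (sigma_gt0 : 0 < sigma) (Pmax_gt0 : 0 < Pmax).
Hypotheses (kappa_gt0 : 0 < kappa) (Dmax_gt1 : 1 < Dmax).

Let Dmax_gt0 : 0 < Dmax. Proof. exact: lt_trans Dmax_gt1. Qed.

(** The maximum in the cosine measure is attained at some direction; when
    [M (grad f x) = 0] every direction will do. *)
Lemma descent_direction (x : 'cV[R]_n) (M : 'M[R]_(r, n)) (D : 'I_m -> 'cV[R]_r) :
  (0 < m)%N -> kappa <= 1 ->
  descent_set kappa Dmax f x M D <->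
  (exists i, kappa * (enorm (D i) * enorm (M *m grad f x))
             <= dotp (D i) (- (M *m grad f x))) /\
  forall i, Dmax^-1 <= enorm (D i) <= Dmax.
Proof.
move=> m_gt0 kappa_le1; rewrite /descent_set /cosine_measure oppr_eq0 enormN.
set w := M *m grad f x; split => -[h hD]; split=> //; move: h.
  case: (eqVneq w 0) => [w0 _|w0 hk].
    by exists (Ordinal m_gt0); rewrite w0 enorm0 oppr0 dotp0r !mulr0.
  suff [i hi] : exists i, kappa <= dotp (D i) (- w) / (enorm (D i) * enorm w).
    exists i; rewrite -ler_pdivlMr // mulr_gt0 ?enorm_gt0 // -enorm_gt0.
    by have /andP[h _] := hD i; apply: lt_le_trans h; rewrite invr_gt0.
  apply: contrapT => /forallNP hN.
  have : \big[Order.max/-1]_(i < m) (dotp (D i) (- w) / (enorm (D i) * enorm w))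
         < kappa.
    apply: (big_ind (fun y => y < kappa)) => [|a b ha hb|i _].
    - by rewrite (lt_trans _ kappa_gt0) // ltrN10.
    - by rewrite gt_max ha hb.
    - by have /negP := hN i; rewrite -ltNge.
  by rewrite ltNge hk.
case=> i hi; case: (eqVneq w 0) => // w0.
apply: le_trans (_ : dotp (D i) (- w) / (enorm (D i) * enorm w) <= _).
  rewrite ler_pdivlMr // mulr_gt0 ?enorm_gt0 // -enorm_gt0.
  by have /andP[h _] := hD i; apply: lt_le_trans h; rewrite invr_gt0.
by rewrite (bigD1 i) //= le_max lexx.
Qed.

(** If no direction decreased [f] enough, then by [descent_lemma] the descent
    direction [d] would satisfy
    [kappa eta |d| |g| <= - d^T M g <= (L + c) / 2 a |M^T d|^2
     <= (L + c) / 2 a Pmax^2 |d|^2],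
    which bounds [a] from below because [|d| <= Dmax <= Dmax^3]. *)
Lemma small_step_success (x : 'cV[R]_n) (M : 'M[R]_(r, n))
    (D : 'I_m -> 'cV[R]_r) (a : R) :
  (0 < m)%N -> kappa <= 1 -> 0 < a ->
  well_aligned eta sigma Pmax f x M -> descent_set kappa Dmax f x M D ->
  a < 2 * kappa * eta / ((L + c) * Pmax ^+ 2 * Dmax ^+ 3) * enorm (grad f x) ->
  exists i, sufficient_decrease f c x a (M^T *m D i).
Proof.
move=> m_gt0 kappa_le1 a0 [al Mmax _ _] /(descent_direction _ _ _ m_gt0 kappa_le1).
case=> -[i hi] hD a_lt; exists i; apply: contrapT => /negP; rewrite -leNgt => hf.
set g := grad f x in al hi a_lt *; set e := enorm (D i).
have /andP[eD1 eD2] := hD i.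
have e0 : 0 < e by rewrite (lt_le_trans _ eD1) ?invr_gt0.
have taylor := descent_lemma x (a *: (M^T *m D i)) df f_lip.
rewrite enormZ gtr0_norm // dotpZr -/g in taylor.
set N := enorm (M^T *m D i) in hf taylor.
have NP : N <= Pmax * e by apply: opnorm_trmx_le => //; exact: ltW.
have dg : dotp g (M^T *m D i) = - dotp (D i) (- (M *m g)).
  by rewrite dotpNr opprK [RHS]dotp_mulmx dotpC.
rewrite {}dg in taylor; set s := dotp (D i) _ in hi taylor.
have s_le : s <= (L + c) / 2 * a * N ^+ 2.
  rewrite -(ler_pM2l a0).
  have := le_trans hf taylor; rewrite exprMn; lra.
have s_ge : kappa * eta * e * enorm g <= s.
  apply: le_trans hi; rewrite -!mulrA ler_pM2l // mulrCA ler_pM2l //.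
have N2 : N ^+ 2 <= Pmax ^+ 2 * e ^+ 2.
  by rewrite -exprMn ler_pXn2r ?nnegrE ?enorm_ge0 // mulr_ge0 ?ltW.
have LcP : 0 < (L + c) * Pmax ^+ 2 by rewrite mulr_gt0 ?exprn_gt0 ?addr_gt0.
have h1 : kappa * eta * enorm g <= (L + c) * Pmax ^+ 2 / 2 * a * e.
  rewrite -(ler_pM2l e0).
  have : (L + c) / 2 * a * N ^+ 2 <= (L + c) / 2 * a * (Pmax ^+ 2 * e ^+ 2).
    by rewrite ler_wpM2l // !mulr_ge0 ?ltW // addr_gt0.
  move: s_le s_ge; rewrite !expr2; lra.
have h2 : e <= Dmax ^+ 3.
  apply: le_trans eD2 _; rewrite -[leLHS]expr1 ler_weXn2l // ltW //.
have h3 : (L + c) * Pmax ^+ 2 / 2 * a * e <= (L + c) * Pmax ^+ 2 / 2 * a * Dmax ^+ 3.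
  by rewrite ler_wpM2l // mulr_ge0 ?(ltW a0) // divr_ge0 ?(ltW LcP).
move: a_lt; rewrite -/g mulrAC ltr_pdivlMr; last by rewrite mulr_gt0 ?exprn_gt0.
apply/negP; rewrite -leNgt.
have := le_trans h1 h3; set K := (L + c) * Pmax ^+ 2; set K3 := Dmax ^+ 3.
lra.
Qed.

Lemma aligned_step_norm (x : 'cV[R]_n) (M : 'M[R]_(r, n)) (u : 'cV[R]_r) :
  (0 < r)%N -> well_aligned eta sigma Pmax f x M -> Dmax^-1 <= enorm u ->
  sigma / Dmax <= enorm (M^T *m u).
Proof.
case: r M u => // r' M u _ [_ _ Mfree Ms] hu.
have /(sigma_min_geP _ sigma_gt0)/(_ u) := conj Mfree Ms.
by apply: le_trans; rewrite ler_pM2l.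
Qed.

End Iteration.
End Smoothness.

(** * Counting good iterations along a run *)

Section Counting.
Context {R : realType}.

(** The step size is followed through [u], its logarithm in base [ginc]
    relative to the threshold below which good iterations must succeed. The
    two terms watch disjoint ranges: the first one earns a unit from every
    uncapped success that stays below [- mu], the second one from every failure
    that stays above [- mu]. The gap of width [mu] under the threshold [0] is what
    keeps a failure that starts above [0] from costing anything in the first
    term. *)
Definition step_potential (mu u : R) : R :=
  Order.min u (- mu) - Order.max u (- mu) / mu.

Lemma potential_good_failure mu u : 0 < mu -> 0 < u ->
  step_potential mu u + 1 = step_potential mu (u - mu).
Proof.
move=> mu0 u0; rewrite /step_potential.
rewrite !min_r ?max_l; try lra.
by rewrite mulrBl divff ?gt_eqF //; lra.
Qed.

Lemma potential_small_success mu u : u <= - (1 + mu) ->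
  step_potential mu u + 1 = step_potential mu (u + 1).
Proof.
move=> hu; rewrite /step_potential.
by rewrite [RHS](_ : _ = u + 1 - (- mu) / mu) ?min_l ?max_r; lra.
Qed.

Lemma potential_success mu u u' : 0 < mu -> u <= u' <= u + 1 ->
  step_potential mu u - mu^-1 <= step_potential mu u'.
Proof.
move=> mu0 /andP[h1 h2]; rewrite /step_potential.
have minle : Order.min u (- mu) <= Order.min u' (- mu) by rewrite le_min !ge_min h1 lexx orbT.
have : Order.max u' (- mu) / mu <= Order.max u (- mu) / mu + mu^-1.
  rewrite -{3}[mu^-1]mul1r -mulrDl ler_pM2r ?invr_gt0 //.
  rewrite ge_max.
  by case: (leP u (- mu)) => ?; apply/andP; split; lra.
lra.
Qed.

Lemma potential_failure mu u : 0 < mu ->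
  step_potential mu u - mu <= step_potential mu (u - mu).
Proof.
move=> mu0; rewrite /step_potential.
have : Order.min u (- mu) - mu <= Order.min (u - mu) (- mu).
  by rewrite le_min; case: (leP u (- mu)) => ?; apply/andP; split; lra.
have : Order.max (u - mu) (- mu) / mu <= Order.max u (- mu) / mu.
  by rewrite ler_pM2r ?invr_gt0 // ge_max; case: (leP u (- mu)) => ?; apply/andP; split; lra.
lra.
Qed.

(** Iteration [j] is good when [Z j] holds and successful when [S j] holds.
    Every good iteration is paid for by the potential or, when it is a success
    with a step that is not small, by a decrease of the objective [F]. An
    iteration that is not good costs [mu] when it fails, as the step may shrink
    below [- mu], and [mu^-1] when it succeeds, as the step may grow above
    [- mu]. *)
Lemma good_le_bad (mu A : R) (u F : nat -> R) (Z S : nat -> bool) (k : nat) :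
  0 < mu -> 0 <= A ->
  (forall j, (j < k)%N -> Z j -> ~~ S j -> 0 < u j) ->
  (forall j, (j < k)%N -> ~~ S j -> u j.+1 = u j - mu /\ F j.+1 <= F j) ->
  (forall j, (j < k)%N -> S j -> u j <= u j.+1 <= u j + 1 /\ F j.+1 <= F j) ->
  (forall j, (j < k)%N -> S j -> u j <= - (1 + mu) -> u j.+1 = u j + 1) ->
  (forall j, (j < k)%N -> Z j -> S j -> - (1 + mu) < u j ->
     1 + mu^-1 <= A * (F j - F j.+1)) ->
  \sum_(j < k) (Z j)%:R <=
  Order.max mu mu^-1 * \sum_(j < k) (~~ Z j)%:R
  + A * (F 0%N - F k) + (step_potential mu (u k) - step_potential mu (u 0%N)).
Proof.
move=> mu0 A0 hZU hU hS hSs hSl.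
have M1 : mu <= Order.max mu mu^-1 by rewrite le_max lexx.
have M2 : mu^-1 <= Order.max mu mu^-1 by rewrite le_max lexx orbT.
set M := Order.max _ _ in M1 M2 *.
elim: k hZU hU hS hSs hSl => [|k IH] hZU hU hS hSs hSl.
  by rewrite !big_ord0 !subrr !mulr0 !addr0.
have {}IH := IH (fun j h => hZU j (ltnW h)) (fun j h => hU j (ltnW h))
  (fun j h => hS j (ltnW h)) (fun j h => hSs j (ltnW h)) (fun j h => hSl j (ltnW h)).
rewrite !big_ord_recr /= mulrDr.
suff : (Z k)%:R <= M * (~~ Z k)%:R + A * (F k - F k.+1)
   + (step_potential mu (u k.+1) - step_potential mu (u k)).
  move: IH; rewrite !mulrBr; lra.
have F_le : 0 <= A * (F k - F k.+1).
  rewrite mulr_ge0 // subr_ge0.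
  by case: (boolP (S k)) => [/hS|/hU] -/(_ (ltnSn k))[].
have := hZU k (ltnSn k); have := hSl k (ltnSn k).
case: (boolP (Z k)) => Zk; case: (boolP (S k)) => Sk /= hl hu.
- rewrite mulr0 add0r; case: (leP (u k) (- (1 + mu))) => uk.
    have := potential_small_success uk; rewrite (hSs k) //; lra.
  have [u_le _] := hS k (ltnSn k) Sk.
  have := potential_success mu0 u_le; have := hl isT isT uk; lra.
- have [-> _] := hU k (ltnSn k) Sk.
  have := potential_good_failure mu0 (hu isT isT); lra.
- have [u_le _] := hS k (ltnSn k) Sk; rewrite mulr1.
  have := potential_success mu0 u_le; lra.
- have [-> _] := hU k (ltnSn k) Sk; rewrite mulr1.
  have := potential_failure (u k) mu0; lra.
Qed.

End Counting.

Section Run.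
Context {R : realType}.

(** This is where [p0] comes from: [p0 / (1 - p0) = max mu mu^-1]. *)
Lemma balance_threshold (mu z b B : R) : 0 < mu ->
  let p0 := Order.max (1 / (1 + mu)) (mu / (1 + mu)) in
  z <= Order.max mu mu^-1 * b + B -> z <= p0 * (z + b) + (1 - p0) * B.
Proof.
move=> mu0 p0 hz.
have mu1 : 0 < 1 + mu by lra.
have mu_neq0 := lt0r_neq0 mu0; have mu1_neq0 := lt0r_neq0 mu1.
have [q1 pM] : 0 < 1 - p0 /\ p0 = (1 - p0) * Order.max mu mu^-1.
  rewrite /p0; case: (leP mu 1) => hmu.
    rewrite max_l; last by rewrite ler_pM2r ?invr_gt0.
    rewrite max_r; last first.
      by rewrite (le_trans hmu) // invf_ge1.
    have -> : 1 - 1 / (1 + mu) = mu / (1 + mu) by field.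
    by split; [exact: divr_gt0|field; rewrite mu1_neq0 mu_neq0].
  rewrite max_r ?ler_pM2r ?invr_gt0 ?(ltW hmu) // max_l; last first.
    by rewrite (le_trans _ (ltW hmu)) // invf_le1 // ltW.
  have -> : 1 - mu / (1 + mu) = 1 / (1 + mu) by field.
  split; [exact: divr_gt0|by field].
have : (1 - p0) * z <= (1 - p0) * (Order.max mu mu^-1 * b + B).
  by rewrite ler_pM2l.
by rewrite mulrDr mulrA -pM; lra.
Qed.

(** [good_le_bad] along one run, as long as the gradient stays large. A good
    failure needs a step above the threshold [a = abar * eps] by
    [small_step_success]; a good success with a step above
    [gdec * a / ginc] decreases [f] by at least
    [c / 2 * (gdec * a / ginc)^2 * (sigma / Dmax)^2], and the weight [A] makes
    such a decrease worth [1 + mu^-1]; the total decrease is at most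
    [f x0 - flow]. *)
Lemma good_iterations_le (n r m : nat) (f : 'cV[R]_n -> R) (L flow : R)
    (x0 : 'cV[R]_n) (alphamax alpha0 c gdec ginc : R)
    (P : nat -> 'M[R]_(r, n)) (D : nat -> 'I_m -> 'cV[R]_r)
    (x : nat -> 'cV[R]_n) (alpha : nat -> R) (E : nat -> {set 'I_m})
    (eta sigma Pmax kappa Dmax eps : R) (k : nat) :
  (0 < m)%N -> (0 < r)%N ->
  (forall y, differentiable f y) -> 0 < L ->
  (forall y z, enorm (grad f y - grad f z) <= L * enorm (y - z)) ->
  (forall y, flow <= f y) ->
  0 < alpha0 <= alphamax -> 0 < c -> 0 < gdec < 1 -> 1 < ginc ->
  0 < eta -> 0 < sigma -> 0 < Pmax -> 0 < kappa <= 1 -> 1 < Dmax ->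
  direct_search f x0 alpha0 alphamax c gdec ginc P D x alpha E ->
  let abar := 2 * kappa * eta / ((L + c) * Pmax ^+ 2 * Dmax ^+ 3) in
  let beta := 2 * Dmax ^+ 2 * (f x0 - flow) / (c * sigma ^+ 2) in
  let mu := logb ginc gdec^-1 in
  let C := (mu * gdec ^+ 2 + ginc ^+ 2) * ginc ^+ 2 * beta / (mu * gdec ^+ 4) in
  let p0 := Order.max (1 / (1 + mu)) (mu / (1 + mu)) in
  let phi := (1 - p0) * C / abar ^+ 2 * eps ^- 2
             + (1 - p0) * logb gdec (gdec ^+ 2 * abar / (ginc * alpha0) * eps) in
  0 < eps <= ginc^-1 * alpha0 / abar ->
  (forall j, (j < k)%N -> eps < enorm (grad f (x j))) ->
  \sum_(j < k) (`[< well_aligned eta sigma Pmax f (x j) (P j) /\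
                    descent_set kappa Dmax f (x j) (P j) (D j) >])%:R
  <= p0 * k%:R + phi.
Proof.
move=> m_gt0 r_gt0 df L_gt0 f_lip f_low /andP[alpha0_gt0 alpha0_le] c_gt0.
move=> /andP[gdec0 gdec1] ginc1 eta_gt0 sigma_gt0 Pmax_gt0.
move=> /andP[kappa_gt0 kappa_le1] Dmax_gt1 [x0E a0E step].
move=> abar beta mu C p0 phi /andP[eps_gt0 eps_le] large.
have Dmax_gt0 : 0 < Dmax by apply: lt_trans Dmax_gt1.
have ginc0 : 0 < ginc by apply: lt_trans ginc1.
have abar_gt0 : 0 < abar by rewrite !(mulr_gt0, invr_gt0, exprn_gt0, addr_gt0).
have [a a_def] : {a | a = abar * eps} by exists (abar * eps).
have a_gt0 : 0 < a by rewrite a_def mulr_gt0.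
have a_le : ginc * a <= alpha0.
  rewrite a_def; have := eps_le; rewrite ler_pdivlMr // ler_pdivlMl //.
  by rewrite [eps * _]mulrC.
pose ell := ln ginc; have ell_gt0 : 0 < ell by rewrite ln_gt0.
have ell_neq0 := lt0r_neq0 ell_gt0.
have lngdec : ln gdec = - (mu * ell).
  by rewrite /mu /logb divfK // lnV ?posrE // opprK.
have mu_gt0 : 0 < mu.
  by rewrite divr_gt0 // ln_gt0 // invf_gt1.
have mu_neq0 := lt0r_neq0 mu_gt0.
pose u j := ln (alpha j / a) / ell.
pose Z j := `[< well_aligned eta sigma Pmax f (x j) (P j) /\
                descent_set kappa Dmax f (x j) (P j) (D j) >].
pose S j := `[< exists i,
  sufficient_decrease f c (x j) (alpha j) ((P j)^T *m D j i) >].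
have stepS j : S j -> exists i, [/\ sufficient_decrease f c (x j) (alpha j)
    ((P j)^T *m D j i), x j.+1 = x j + alpha j *: ((P j)^T *m D j i) &
    alpha j.+1 = Order.min (ginc * alpha j) alphamax].
  by move=> /asboolP[i hi]; case: (step j) => [[i' []]|[/(_ i)]] // *; exists i'.
have stepU j : ~~ S j -> x j.+1 = x j /\ alpha j.+1 = gdec * alpha j.
  move=> /asboolPn hS; case: (step j) => [[i [_ hi _ _]]|[_ _ ? ?]] //.
  by case: hS; exists i.
have alphaP j : 0 < alpha j <= alphamax.
  elim: j => [|j /andP[h1 h2]]; first by rewrite a0E alpha0_gt0.
  case: (boolP (S j)) => [/stepS[i [_ _ ->]]|/stepU[_ ->]].
    rewrite lt_min ge_min lexx orbT andbT mulr_gt0 //.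
    exact: lt_le_trans h1 h2.
  rewrite mulr_gt0 //=; apply: le_trans h2.
  by rewrite ger_pMl // ltW.
have alpha_gt0 j : 0 < alpha j by have /andP[] := alphaP j.
have u_mono y z : 0 < y -> y <= z -> ln (y / a) / ell <= ln (z / a) / ell.
  move=> y0 yz; rewrite ler_pM2r ?invr_gt0 // ler_ln ?posrE ?divr_gt0 //.
    by rewrite ler_pM2r ?invr_gt0.
  exact: lt_le_trans y0 yz.
have u_ginc y : 0 < y -> ln (ginc * y / a) / ell = ln (y / a) / ell + 1.
  move=> y0; rewrite -mulrA lnM ?posrE ?divr_gt0 // mulrDl divff //.
  by rewrite addrC.
have u_gdec y : 0 < y -> ln (gdec * y / a) / ell = ln (y / a) / ell - mu.
  move=> y0; rewrite -mulrA lnM ?posrE ?divr_gt0 // lngdec.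
  by field.
have u_thr : ln (a * gdec / ginc / a) / ell = - (1 + mu).
  have -> : a * gdec / ginc / a = gdec / ginc by field; rewrite !gt_eqF.
  by rewrite ln_div ?posrE // lngdec -/ell; field.
pose A := (1 + mu^-1) *
  (2 * Dmax ^+ 2 * ginc ^+ 2 / (c * sigma ^+ 2 * gdec ^+ 2 * a ^+ 2)).
have A_ge0 : 0 <= A.
  rewrite mulr_ge0 //; first by rewrite addr_ge0 // invr_ge0 ltW.
  by apply: divr_ge0; apply: ltW; rewrite ?(exprn_gt0, mulr_gt0) //.
have bound : \sum_(j < k) (Z j)%:R <=
    Order.max mu mu^-1 * \sum_(j < k) (~~ Z j)%:R + A * (f (x 0) - f (x k))
    + (step_potential mu (u k) - step_potential mu (u 0)).
  apply: (@good_le_bad _ _ _ _ (f \o x) _ S) => //.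
  - move=> j jk /asboolP[wa ds] /asboolPn hS.
    rewrite divr_gt0 // ln_gt0 // ltr_pdivlMr // mul1r ltNge; apply/negP => ale.
    apply: hS; apply: (small_step_success (L := L) (eta := eta) (sigma := sigma)
      (Pmax := Pmax) (kappa := kappa) (Dmax := Dmax)) => //.
    by apply: le_lt_trans ale _; rewrite a_def ltr_pM2l // large.
  - by move=> j _ /stepU[xE aE]; rewrite /u aE u_gdec //= xE.
  - move=> j _ /stepS[i [hf xE aE]]; rewrite /u aE /= -u_ginc //; split.
      have /andP[aj1 aj2] := alphaP j; apply/andP; split; apply: u_mono => //.
      + by rewrite le_min aj2 andbT ler_peMl // ltW.
      + by rewrite lt_min mulr_gt0 //= (lt_le_trans aj1).
      + by rewrite ge_min lexx.
    rewrite xE; apply: (le_trans (ltW hf)); rewrite gerBl.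
    by rewrite mulr_ge0 ?sqr_ge0 // mulr_ge0 ?sqr_ge0 // divr_ge0 // ltW.
  - move=> j _ /stepS[i [_ _ aE]] u_small; rewrite /u aE min_l ?u_ginc //.
    have : alpha j <= a * gdec / ginc.
      rewrite leNgt; apply/negP => h; move: u_small; apply/negP; rewrite -ltNge.
      rewrite -u_thr ltr_pM2r ?invr_gt0 // ltr_ln ?posrE ?divr_gt0 ?mulr_gt0 ?invr_gt0 //.
      by rewrite ltr_pM2r ?invr_gt0.
    (* The cap is inactive: [ginc * alpha j <= a * gdec < a <= alpha0 / ginc]. *)
    rewrite ler_pdivlMr // mulrC => /le_trans; apply.
    apply: le_trans alpha0_le; apply: le_trans a_le; rewrite mulrC.
    by rewrite ler_pM2r // ltW // (lt_trans gdec1).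
  - move=> j _ /asboolP[wa [_ dD]] /stepS[i [hf xE _]] u_large; rewrite /= xE.
    have al : a * gdec / ginc <= alpha j.
      rewrite leNgt; apply/negP => h; move: u_large; apply/negP; rewrite -leNgt.
      by rewrite -u_thr; apply: u_mono => //; exact: ltW.
    have /andP[di _] := dD i.
    have sn := aligned_step_norm sigma_gt0 r_gt0 wa di.
    set N := enorm _ in hf sn.
    have N2 : (a * gdec / ginc) ^+ 2 * (sigma / Dmax) ^+ 2 <= alpha j ^+ 2 * N ^+ 2.
      apply: ler_pM; rewrite ?sqr_ge0 // ler_pXn2r // nnegrE.
      + by rewrite ltW // divr_gt0 // mulr_gt0.
      + by rewrite ltW.
      + by rewrite ltW // divr_gt0.
      + exact: enorm_ge0.
    have fdec : c / 2 * ((a * gdec / ginc) ^+ 2 * (sigma / Dmax) ^+ 2) <=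
        f (x j) - f (x j + alpha j *: ((P j)^T *m D j i)).
      have : c / 2 * ((a * gdec / ginc) ^+ 2 * (sigma / Dmax) ^+ 2) <=
        c / 2 * (alpha j ^+ 2 * N ^+ 2) by rewrite ler_wpM2l // divr_ge0 // ltW.
      by move: hf; rewrite /sufficient_decrease -/N -mulrA; lra.
    apply: le_trans (ler_wpM2l A_ge0 fdec); rewrite le_eqVlt; apply/orP; left.
    apply/eqP; rewrite /A; field.
    by rewrite !gt_eqF.
have hz : \sum_(j < k) (Z j)%:R <= Order.max mu mu^-1 * \sum_(j < k) (~~ Z j)%:R
   + (C / abar ^+ 2 * eps ^- 2
      + logb gdec (gdec ^+ 2 * abar / (ginc * alpha0) * eps)).
  apply: (le_trans bound); rewrite -addrA lerD2l lerD //.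
    pose rho := ginc ^+ 2 / gdec ^+ 2.
    have rho1 : 1 <= rho.
      rewrite ler_pdivlMr ?exprn_gt0 // mul1r ler_pXn2r ?nnegrE ?ltW //.
      exact: lt_trans ginc1.
    have beta0 : 0 <= beta.
      apply: divr_ge0; last by rewrite ltW // mulr_gt0 ?exprn_gt0.
      by rewrite mulr_ge0 ?subr_ge0 // mulr_ge0 ?sqr_ge0.
    apply: (@le_trans _ _ (A * (f x0 - flow))).
      by rewrite x0E ler_wpM2l // lerB.
    have -> : A * (f x0 - flow) = (1 + mu^-1) * rho * beta / a ^+ 2.
      by rewrite /A /rho /beta; field; rewrite !gt_eqF.
    have -> : C / abar ^+ 2 / eps ^+ 2 = (rho + rho ^+ 2 / mu) * beta / a ^+ 2.
      by rewrite /C /rho a_def; field; rewrite !gt_eqF.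
    rewrite ler_pM2r ?invr_gt0 ?exprn_gt0 // ler_wpM2r // mulrDl mul1r lerD2l.
    by rewrite mulrC ler_pM2r ?invr_gt0 // expr2 ler_peMr // (le_trans ler01).
  have u0_ge0 : 0 <= u 0.
    rewrite /u divr_ge0 ?(ltW ell_gt0) // ln_ge0 // a0E ler_pdivlMr // mul1r.
    by apply: le_trans a_le; rewrite ler_peMl // ltW.
  have -> : logb gdec (gdec ^+ 2 * abar / (ginc * alpha0) * eps)
          = 2 + (u 0 + 1) / mu.
    have -> : gdec ^+ 2 * abar / (ginc * alpha0) * eps
            = gdec * gdec / ginc / (alpha0 / a).
      by rewrite a_def; field; rewrite !gt_eqF.
    rewrite /u a0E /logb ln_div ?posrE ?divr_gt0 ?mulr_gt0 //.
    rewrite ln_div ?posrE ?mulr_gt0 // lnM ?posrE // lngdec -/ell.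
    by field; rewrite ell_neq0 mu_neq0.
  have p0E : step_potential mu (u 0) = - mu - u 0 / mu.
    by rewrite /step_potential min_r ?max_l //; lra.
  have pk : step_potential mu (u k) <= - mu + 1.
    have : Order.min (u k) (- mu) <= - mu by rewrite ge_min lexx orbT.
    have : - mu / mu <= Order.max (u k) (- mu) / mu.
      by rewrite ler_pM2r ?invr_gt0 // le_max lexx orbT.
    by rewrite /step_potential mulNr divff //; lra.
  have : 0 < mu^-1 by rewrite invr_gt0.
  by rewrite p0E mulrDl; lra.
have kE : k%:R = \sum_(j < k) (Z j)%:R + \sum_(j < k) (~~ Z j)%:R :> R.
  rewrite -big_split /= -[in LHS](card_ord k) -sum1_card natr_sum.
  by apply: eq_bigr => j _; case: (Z j) => /=; rewrite ?addr0 ?add0r.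
rewrite kE; apply: le_trans (balance_threshold mu_gt0 hz) _.
by rewrite -/p0 lerD2l /phi mulrDr !mulrA.
Qed.
End Run.

(** * Measurability of the events *)

Section Continuity.
Context {R : realType}.

Lemma continuous_enorm (V : topologicalType) n (h : V -> 'cV[R]_n) :
  (forall i, continuous (fun v => h v i 0)) -> continuous (fun v => enorm (h v)).
Proof.
move=> hc v; apply: (@continuous_comp _ _ _ _ Num.sqrt); last exact: sqrt_continuous.
apply: continuous_big => [|i _ {}v]; first exact: add_continuous.
by apply: (@continuous_comp _ _ _ _ (fun y : R => y ^+ 2));
  [exact: hc|exact: exprn_continuous].
Qed.

Lemma enorm_mulmx_continuous r n (v : 'cV[R]_n) :
  continuous (fun M : 'M[R]_(r, n) => enorm (M *m v)).
Proof.
apply: continuous_enorm => i; under eq_fun do rewrite mxE.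
apply: continuous_big => [|j _ M]; first exact: add_continuous.
apply: (@continuousM R _ (fun M : 'M[R]_(r, n) => M i j) (fun=> v j 0)).
  exact: coord_continuous.
exact: cst_continuous.
Qed.

Lemma enorm_trmx_mulmx_continuous r n (u : 'cV[R]_r) :
  continuous (fun M : 'M[R]_(r, n) => enorm (M^T *m u)).
Proof.
apply: continuous_enorm => i; under eq_fun do rewrite mxE.
apply: continuous_big => [|j _ M]; first exact: add_continuous.
under eq_fun do rewrite mxE.
apply: (@continuousM R _ (fun M : 'M[R]_(r, n) => M j i) (fun=> u j 0)).
  exact: coord_continuous.
exact: cst_continuous.
Qed.

Lemma closed_opnorm_le r n (K : R) : 0 <= K ->
  closed [set M : 'M[R]_(r, n) | opnorm M <= K].
Proof.
move=> K0; rewrite [X in closed X](_ : _ = \bigcap_(v in [set: 'cV[R]_n])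
  (fun M : 'M[R]_(r, n) => enorm (M *m v)) @^-1` [set y | y <= K * enorm v]).
  apply: closed_bigI => v _; apply: preimage_closed; last exact: closed_le.
  by move=> M _; exact: enorm_mulmx_continuous.
apply/seteqP; split => M /=.
  by move=> /(opnorm_leP _ K0) + v _; exact.
by move=> MK; apply/(opnorm_leP _ K0) => v; exact: MK.
Qed.

Lemma closed_sigma_min_ge r n (s : R) : 0 < s ->
  closed [set M : 'M[R]_(r.+1, n) | row_free M /\ s <= sigma_min M].
Proof.
move=> s0; rewrite [X in closed X](_ : _ = \bigcap_(u in [set: 'cV[R]_r.+1])
  (fun M : 'M[R]_(r.+1, n) => enorm (M^T *m u)) @^-1` [set y | s * enorm u <= y]).
  apply: closed_bigI => u _; apply: preimage_closed; last exact: closed_ge.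
  by move=> M _; exact: enorm_trmx_mulmx_continuous.
apply/seteqP; split => M /=.
  by move=> /(sigma_min_geP _ s0) + u _; exact.
by move=> hM; apply/(sigma_min_geP _ s0) => u; exact: hM.
Qed.

End Continuity.

Section Measurability.
Context d {T : measurableType d} {R : realType}.

Lemma adapted_open (V : topologicalType) (X : T -> V) (U : set V) :
  adapted (@measurable d T) X -> open U -> measurable (X @^-1` U).
Proof. by move=> hX Uo; apply: hX; exists U. Qed.

Lemma adapted_closed (V : topologicalType) (X : T -> V) (F : set V) :
  adapted (@measurable d T) X -> closed F -> measurable (X @^-1` F).
Proof.
move=> hX Fc; rewrite -[F]setCK preimage_setC; apply: measurableC.
exact: (adapted_open hX (closed_openC Fc)).
Qed.

Lemma measurable_adapted (V : topologicalType) (X : T -> V) (h : V -> R) :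
  adapted (@measurable d T) X -> continuous h ->
  measurable_fun [set: T] (h \o X).
Proof.
move=> hX /continuousP ch; apply: (measurability _ (RGenOpens.measurableE R)).
move=> _ [_ [a [b ->] <-]]; rewrite setTI comp_preimage.
by apply: (adapted_open hX); apply: ch; exact: interval_open.
Qed.

Lemma measurable_coord r n (X : T -> 'M[R]_(r, n)) i j :
  adapted (@measurable d T) X -> measurable_fun [set: T] (fun w => X w i j).
Proof.
move=> hX; apply: (@measurable_adapted _ X (fun M : 'M[R]_(r, n) => M i j)) => //.
exact: coord_continuous.
Qed.

Lemma measurable_enorm n (X : T -> 'cV[R]_n) :
  (forall i, measurable_fun [set: T] (fun w => X w i 0)) ->
  measurable_fun [set: T] (fun w => enorm (X w)).
Proof.
move=> mX; apply: (@measurableT_comp _ _ _ _ _ _ (@Num.sqrt R)).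
  by apply: continuous_measurable_fun; exact: sqrt_continuous.
by apply: measurable_sum => i; exact: measurable_funX.
Qed.

Lemma measurable_dotp n (X Y : T -> 'cV[R]_n) :
  (forall i, measurable_fun [set: T] (fun w => X w i 0)) ->
  (forall i, measurable_fun [set: T] (fun w => Y w i 0)) ->
  measurable_fun [set: T] (fun w => dotp (X w) (Y w)).
Proof.
move=> mX mY; under eq_fun do rewrite dotpE.
by apply: measurable_sum => i; exact: measurable_funM.
Qed.

Lemma measurable_mulmx_coord r n (M : T -> 'M[R]_(r, n)) (X : T -> 'cV[R]_n) :
  (forall i j, measurable_fun [set: T] (fun w => M w i j)) ->
  (forall i, measurable_fun [set: T] (fun w => X w i 0)) ->
  forall i, measurable_fun [set: T] (fun w => (M w *m X w) i 0).
Proof.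
move=> mM mX i; under eq_fun do rewrite mxE.
by apply: measurable_sum => j; exact: measurable_funM.
Qed.

Lemma measurable_le (g h : T -> R) :
  measurable_fun [set: T] g -> measurable_fun [set: T] h ->
  measurable [set w | g w <= h w].
Proof.
by move=> mg mh; rewrite -[X in measurable X]setTI; exact: measurable_fun_le.
Qed.

Section Events.
Variables (n r m : nat) (f : 'cV[R]_n -> R) (x : T -> 'cV[R]_n).
Variables (P : T -> 'M[R]_(r, n)) (D : T -> 'I_m -> 'cV[R]_r).
Hypotheses (f_C1 : continuous (grad f)) (x_adapted : adapted (@measurable d T) x)
  (P_adapted : adapted (@measurable d T) P).

Lemma measurable_grad_coord i :
  measurable_fun [set: T] (fun w => grad f (x w) i 0).
Proof.
apply: (@measurable_adapted _ x (fun y => grad f y i 0)) => // y.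
apply: (@continuous_comp _ _ _ (grad f) (fun v : 'cV[R]_n => v i 0)).
  exact: f_C1.
exact: coord_continuous.
Qed.

Lemma measurable_enorm_grad : measurable_fun [set: T] (fun w => enorm (grad f (x w))).
Proof. by apply: measurable_enorm; exact: measurable_grad_coord. Qed.

(** A probability says nothing about a set that is not measurable, so the events
    that are conditioned on have to be shown measurable. The conditions on
    [opnorm] and [sigma_min] define closed sets of matrices by [opnorm_leP] and
    [sigma_min_geP]; the other one involves [P] and [x] jointly, but
    through the square roots of polynomials in the coordinates of [P] and
    [grad f x]. *)
Lemma measurable_well_aligned eta sigma Pmax :
  (0 < r)%N -> 0 < sigma -> 0 < Pmax ->
  measurable [set w | well_aligned eta sigma Pmax f (x w) (P w)].
Proof.
case: r P P_adapted => // r' M mM _ s0 P0.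
rewrite [X in measurable X](_ : _ =
  [set w | eta * enorm (grad f (x w)) <= enorm (M w *m grad f (x w))] `&`
  M @^-1` [set N | opnorm N <= Pmax] `&`
  M @^-1` [set N | row_free N /\ sigma <= sigma_min N]); last first.
  by apply/seteqP; split => w /= [] => [? ? ? ?|[? ?] [? ?]].
apply: measurableI; last exact: (adapted_closed mM (@closed_sigma_min_ge R r' n sigma s0)).
apply: measurableI; last exact: (adapted_closed mM (@closed_opnorm_le R r'.+1 n Pmax (ltW P0))).
apply: measurable_le.
  apply: (@measurable_funM _ _ _ _ (cst eta)); first exact: measurable_cst.
  exact: measurable_enorm_grad.
apply: measurable_enorm; apply: measurable_mulmx_coord => [i j|].
  exact: (measurable_coord i j mM).
exact: measurable_grad_coord.
Qed.

Lemma measurable_descent_set kappa Dmax :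
  (0 < m)%N -> 0 < kappa <= 1 -> 1 < Dmax ->
  (forall i, adapted (@measurable d T) (D ^~ i)) ->
  measurable [set w | descent_set kappa Dmax f (x w) (P w) (D w)].
Proof.
move=> m0 /andP[k0 k1] D1 mD.
have mDc i j : measurable_fun [set: T] (fun w => D w i j 0).
  exact: (measurable_coord j 0 (mD i)).
have mw : forall i, measurable_fun [set: T] (fun w => (P w *m grad f (x w)) i 0).
  apply: measurable_mulmx_coord => [i j|]; last exact: measurable_grad_coord.
  exact: (measurable_coord i j P_adapted).
rewrite [X in measurable X](_ : _ = (\bigcup_(i in [set: 'I_m])
    [set w | kappa * (enorm (D w i) * enorm (P w *m grad f (x w)))
             <= dotp (D w i) (- (P w *m grad f (x w)))])
  `&` \bigcap_(i in [set: 'I_m])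
    ([set w | Dmax^-1 <= enorm (D w i)] `&` [set w | enorm (D w i) <= Dmax])).
  apply: measurableI.
    apply: fin_bigcup_measurable => [|i _]; first exact: finite_finset.
    apply: measurable_le.
      apply: (@measurable_funM _ _ _ _ (cst kappa)); first exact: measurable_cst.
      apply: (@measurable_funM _ _ _ _ (fun w => enorm (D w i))
                (fun w => enorm (P w *m grad f (x w)))).
        by apply: measurable_enorm; exact: mDc.
      exact: measurable_enorm.
    apply: measurable_dotp => // j.
    by under eq_fun do rewrite mxE; exact: measurableT_comp.
  apply: fin_bigcap_measurable => [|i _]; first exact: finite_finset.
  by apply: measurableI; apply: measurable_le => //; exact: measurable_enorm.
apply/seteqP; split => w /=.
  move=> /(descent_direction f k0 D1 _ _ _ m0 k1)[[i hi] hD]; split; first by exists i.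
  by move=> j _; apply/andP.
move=> [[i _ hi] hD]; apply/(descent_direction f k0 D1 _ _ _ m0 k1); split; first by exists i.
by move=> j; apply/andP; exact: hD.
Qed.

End Events.
End Measurability.

(** * A Chernoff bound for adapted events *)

Section ConditionalProbability.
Context d {T : measurableType d} {R : realType} (Pr : probability T R).

(** [Z] may be replaced by the nonnegative [max Z q], to which it is equal almost
    everywhere. *)
Lemma cond_prob_ge_le (G : set (set T)) (A B : set T) (q : R) :
  G `<=` @measurable d T -> 0 <= q -> cond_prob_ge Pr G A q -> G B ->
  (q%:E * Pr B <= Pr (A `&` B))%E.
Proof.
move=> GT q0 [Z [_ Zint ZA] Zq] GB; rewrite -ZA //.
have mB : measurable B := GT _ GB.
have mZ : measurable_fun [set: T] Z.
  by apply/measurable_EFinP; exact: measurable_int Zint.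
have mZq : measurable_fun B (EFin \o (Z \max cst q)).
  apply/measurable_EFinP/measurable_maxr; last exact: measurable_cst.
  exact: measurable_funTS.
rewrite (@ae_eq_integral _ _ _ Pr B (EFin \o (Z \max cst q))) //.
- rewrite -integral_cst //; apply: ge0_le_integral => // w _ /=.
  by rewrite lee_fin le_max lexx orbT.
- by apply/measurable_EFinP; exact: measurable_funTS.
- apply: filterS Zq => w Zw _ /=; congr (_%:E).
  by rewrite max_l.
Qed.

End ConditionalProbability.

Section Counts.
Context d {T : measurableType d}.

Definition count_upto (Z : nat -> T -> bool) (k : nat) (w : T) : nat :=
  \sum_(i < k) Z i w.

Lemma measurable_count_level (Z : nat -> T -> bool) k j :
  (forall i, (i < k)%N -> measurable [set w | Z i w]) ->
  measurable [set w | count_upto Z k w = j].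
Proof.
pose level k j := [set w | count_upto Z k w = j].
elim: k j => [|k IH] j mZ.
  have [->|j0] := eqVneq j 0%N.
    by rewrite [X in measurable X](_ : _ = setT) //; apply/seteqP; split => w // _;
      rewrite /level /= /count_upto big_ord0.
  rewrite [X in measurable X](_ : _ = set0) //; apply/seteqP; split => w //.
  by rewrite /level /= /count_upto big_ord0 => /esym/eqP; rewrite (negbTE j0).
have {}IH i : measurable (level k i) by apply: IH => l lk; exact/mZ/ltnW.
have mk := mZ k (ltnSn k).
rewrite [X in measurable X](_ : _ = (level k j `\` [set w | Z k w]) `|`
    ([set w | (count_upto Z k w).+1 = j] `&` [set w | Z k w])); last first.
  apply/seteqP; split => w; rewrite /level /count_upto /= big_ord_recr /=.
    by case: (Z k w); rewrite ?addn1 ?addn0; [right|left].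
  by case=> [[<-]|[<-]]; case: (Z k w); rewrite ?addn1 ?addn0.
apply: measurableU; first exact: measurableD.
apply: measurableI => //.
case: j => [|j]; first by rewrite [X in measurable X](_ : _ = set0) //; apply/seteqP; split.
rewrite [X in measurable X](_ : _ = level k j) //.
by apply/seteqP; split => w; rewrite /level /=; [move=> [->]|move=> ->].
Qed.

End Counts.

Section Chernoff.
Context d {T : measurableType d} {R : realType} (Pr : probability T R).

Lemma expRN_le_quadratic (t : R) : 0 <= t -> expR (- t) <= 1 - t + t ^+ 2 / 2.
Proof.
move=> t0.
pose g (u : R) := expR (- u) - (1 - u + (u * u) / 2).
pose dg (u : R) := - expR (- u) - (u - 1).
have gD (u : R) : is_derive u 1 g (dg u).
  by apply: is_derive_eq; rewrite /dg /GRing.scale /= !mulr1; field.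
have g_cont : {within `[0, t], continuous g}.
  apply: continuous_subspaceT => u.
  by apply/differentiable_continuous/derivable1_diffP; case: (gD u).
have [c _] := MVT_segment t0 (fun u _ => gD u) g_cont.
have : dg c <= 0 by have := expR_ge1Dx (- c); rewrite /dg; lra.
rewrite /g /dg subr0 oppr0 expR0 mul0r => dc gE.
have : (- expR (- c) - (c - 1)) * t <= 0 by rewrite mulr_le0_ge0.
by rewrite expr2; lra.
Qed.

Variables (Z : nat -> T -> bool) (pi : R).

Let level k j := [set w | count_upto Z k w = j].
Let good k := [set w | Z k w].

Hypothesis pi_gt0 : 0 < pi.
Hypothesis mgood : forall k, measurable (good k).
Hypothesis good_ge :
  forall k j, (pi%:E * Pr (level k j) <= Pr (good k `&` level k j))%E.

Let measurable_level k j : measurable (level k j).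
Proof. by apply: measurable_count_level => i _; exact: mgood. Qed.

Let prob (A : set T) : R := fine (Pr A).

Let probE A : measurable A -> Pr A = (prob A)%:E.
Proof. by move=> mA; rewrite /prob fineK // fin_num_measure. Qed.

Let a k j := prob (level k j).
Let b k j := prob (good k `&` level k j).

Let a_ge0 k j : 0 <= a k j.
Proof. by rewrite fine_ge0. Qed.

Let b_ge0 k j : 0 <= b k j.
Proof. by rewrite fine_ge0. Qed.

Let mgl k j : measurable (good k `&` level k j).
Proof. by apply: measurableI; [exact: mgood|exact: measurable_level]. Qed.

Let ab k j : pi * a k j <= b k j.
Proof.
have := good_ge k j; rewrite (probE (mgl k j)).
by rewrite (probE (measurable_level k j)) -EFinM lee_fin.
Qed.

Let a_step k j : a k.+1 j = a k j - b k j + (if j is j'.+1 then b k j' else 0).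
Proof.
have -> : a k j - b k j = prob (level k j `\` good k).
  apply/eqP; rewrite subr_eq eq_sym -eqe EFinD; apply/eqP.
  rewrite -!probE //; last exact: measurableD.
  by rewrite setIC -measureDI.
case: j => [|j].
  rewrite addr0 /a; congr prob; apply/seteqP.
  split => w; rewrite /level /good /count_upto /= big_ord_recr /=.
    by case: (Z k w); rewrite ?addn1 ?addn0.
  by case=> h nz; move: nz h; case: (Z k w); rewrite ?addn1 ?addn0.
apply: EFin_inj; rewrite EFinD /a /b -!probE //; last exact: measurableD.
rewrite -measureU //; last 2 first.
- exact: measurableD.
- by apply/seteqP; split => w // -[[_ ?] [? _]].
congr (Pr _); apply/seteqP; split => w; rewrite /level /good /count_upto /= big_ord_recr /=.
  by case: (Z k w); rewrite ?addn1 ?addn0; [right; case: H|left].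
by case=> [[<-]|[+ <-]]; case: (Z k w); rewrite ?addn1 ?addn0.
Qed.

(** The moment generating function of the number of good iterations gains at
    most the factor [1 - pi (1 - exp (- t))] at each iteration. Cutting the
    sum at an arbitrary level [N] only loses nonnegative terms. *)
Lemma mgf_step t k N : 0 <= t ->
  \sum_(j < N) expR (- t * j%:R) * a k.+1 j <=
  (1 - pi * (1 - expR (- t))) * \sum_(j < N) expR (- t * j%:R) * a k j.
Proof.
move=> t0.
have shift : \sum_(j < N) expR (- t * j%:R) * (if (j : nat) is j'.+1 then b k j' else 0)
    <= expR (- t) * \sum_(j < N) expR (- t * j%:R) * b k j.
  case: N => [|N]; first by rewrite !big_ord0 mulr0.
  rewrite big_ord_recl mulr0 add0r big_ord_recr /= mulrDr mulr_sumr.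
  rewrite -[leLHS]addr0 lerD //; last by rewrite !mulr_ge0 ?expR_ge0.
  rewrite le_eqVlt; apply/orP; left; apply/eqP; apply: eq_bigr => j _.
  by rewrite mulrA -expRD /bump /= add1n -natr1 mulrDr mulr1 addrC.
apply: (@le_trans _ _ (\sum_(j < N) expR (- t * j%:R) *
    (a k j - (1 - expR (- t)) * b k j))).
  have -> : \sum_(j < N) expR (- t * j%:R) * (a k j - (1 - expR (- t)) * b k j)
     = \sum_(j < N) expR (- t * j%:R) * (a k j - b k j)
       + expR (- t) * \sum_(j < N) expR (- t * j%:R) * b k j.
    by rewrite mulr_sumr -big_split /=; apply: eq_bigr => j _; ring.
  under eq_bigr do rewrite a_step mulrDr.
  by rewrite big_split /= lerD2l.
rewrite mulr_sumr ler_sum // => j _.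
rewrite mulrCA ler_wpM2l ?expR_ge0 //.
have e1 : 0 <= 1 - expR (- t) by rewrite subr_ge0 expR_le1 oppr_le0.
have := ler_wpM2l e1 (ab k j); nra.
Qed.

Lemma mgf_le t k N : 0 <= t ->
  \sum_(j < N) expR (- t * j%:R) * a k j <= expR (- (pi * (1 - expR (- t))) * k%:R).
Proof.
move=> t0; elim: k => [|k IH].
  rewrite mulr0 expR0; case: N => [|N]; first by rewrite big_ord0.
  rewrite big_ord_recl big1 ?addr0 => [|j _].
    rewrite mulr0 expR0 mul1r -lee_fin -probE; last exact: measurable_level.
    by apply: probability_le1; exact: measurable_level.
  rewrite /a (_ : level 0 _ = set0) ?/prob ?measure0 ?mulr0 //.
  by apply/seteqP; split => w //; rewrite /level /= /count_upto big_ord0.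
apply: le_trans (mgf_step k N t0) _.
set y := - (pi * _).
have -> : expR (y * k.+1%:R) = expR y * expR (y * k%:R).
  by rewrite -expRD -natr1 mulrDr mulr1 addrC.
apply: (@le_trans _ _ (expR y * \sum_(j < N) expR (- t * j%:R) * a k j)).
  rewrite ler_wpM2r ?sumr_ge0 ?expR_ge1Dx // => j _.
  by rewrite mulr_ge0 ?expR_ge0.
by rewrite ler_wpM2l ?expR_ge0.
Qed.

(** Markov's inequality for [exp (- t S)], with [t = (pi - lam) / pi], the
    minimizer of the quadratic bound [t lam - pi (t - t^2 / 2)] of the
    exponent. *)
Lemma chernoff_count (lam : R) k : 0 <= lam -> lam <= pi ->
  (Pr [set w | ((count_upto Z k w)%:R <= lam * k%:R)%R] <=
   (expR (- ((pi - lam) ^+ 2 / (2 * pi)) * k%:R))%:E)%E.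
Proof.
move=> lam0 lampi.
pose t := (pi - lam) / pi.
have t0 : 0 <= t by rewrite divr_ge0 ?subr_ge0 // ltW.
have count_le w : (count_upto Z k w <= k)%N.
  rewrite /count_upto -[leqRHS]card_ord -sum1_card; apply: leq_sum => i _.
  exact: leq_b1.
pose F j := if (j%:R <= lam * k%:R :> R) then level k j else set0.
have mF j : measurable (F j).
  by rewrite /F; case: ifP => // _; exact: measurable_level.
have sub : [set w | ((count_upto Z k w)%:R <= lam * k%:R)%R] = \big[setU/set0]_(j < k.+1) F j.
  rewrite -bigcup_mkord; apply/seteqP; split => w /=.
    by move=> h; exists (count_upto Z k w); [rewrite /= ltnS|rewrite /F h].
  by move=> [j _]; rewrite /F; case: ifP => //= h; rewrite /level /= => ->.
rewrite sub; apply: (@le_trans _ _ (\sum_(j < k.+1) Pr (F j))%E).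
  exact: Boole_inequality.
apply: (@le_trans _ _ (\sum_(j < k.+1) (expR (t * (lam * k%:R) - t * j%:R) * a k j)%:E)%E).
  apply: lee_sum => j _; rewrite /F; case: ifP => h.
    rewrite probE ?lee_fin; last exact: measurable_level.
    apply: ler_peMl; first exact: a_ge0.
    by rewrite -[leLHS]expR0 ler_expR subr_ge0 ler_wpM2l.
  by rewrite measure0 lee_fin mulr_ge0 ?expR_ge0.
rewrite sumEFin lee_fin.
under eq_bigr do rewrite expRD -mulrA -mulNr.
rewrite -mulr_sumr; apply: le_trans (ler_wpM2l (expR_ge0 _) (mgf_le _ _ t0)) _.
rewrite -expRD ler_expR mulrA -mulrDl ler_wpM2r //.
have q := expRN_le_quadratic t0.
have : pi * (1 - expR (- t)) >= pi * (t - t ^+ 2 / 2).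
  by rewrite ler_pM2l //; lra.
suff -> : - ((pi - lam) ^+ 2 / (2 * pi)) = t * lam - pi * (t - t ^+ 2 / 2) by lra.
by rewrite /t; field; rewrite gt_eqF.
Qed.

End Chernoff.

(** * The random algorithm *)

Section Filtration.
Context d {T : measurableType d} {R : realType} (r n m : nat).
Variables (P : nat -> T -> 'M[R]_(r, n)) (D : nat -> T -> 'I_m -> 'cV[R]_r).

Lemma hist_gen_le k k' : (k <= k')%N -> hist_gen P D k `<=` hist_gen P D k'.
Proof.
by move=> kk' A [j jk hA]; exists j => //; exact: leq_trans kk'.
Qed.

Lemma hist_le k k' : (k <= k')%N -> hist P D k `<=` hist P D k'.
Proof. by move=> kk'; apply: sub_sigma_algebra2; exact: hist_gen_le. Qed.

Lemma hist_sub_half k : hist P D k `<=` hist_half P D k.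
Proof. by apply: sub_sigma_algebra2; exact: subsetUl. Qed.

Lemma adapted_P_half k : adapted (hist_half P D k) (P k).
Proof. by move=> A hA; apply: sub_sigma_algebra; right. Qed.

Lemma adapted_P k : adapted (hist P D k.+1) (P k).
Proof.
by move=> A hA; apply: sub_sigma_algebra; exists k; [exact: ltnSn|left].
Qed.

Lemma adapted_D k i : adapted (hist P D k.+1) (D k ^~ i).
Proof.
move=> A hA; apply: sub_sigma_algebra; exists k; first exact: ltnSn.
by right; exists i.
Qed.

Hypotheses (mP : forall k, adapted (@measurable d T) (P k))
  (mD : forall k i, adapted (@measurable d T) (D k ^~ i)).

Lemma hist_gen_measurable k : hist_gen P D k `<=` @measurable d T.
Proof. by move=> A [j _ [/mP//|[i _ /mD]]]. Qed.

Lemma hist_measurable k : hist P D k `<=` @measurable d T.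
Proof.
apply: smallest_sub; first exact: sigma_algebra_measurable.
exact: hist_gen_measurable.
Qed.

Lemma hist_half_measurable k : hist_half P D k `<=` @measurable d T.
Proof.
apply: smallest_sub; first exact: sigma_algebra_measurable.
by rewrite subUset; split; [exact: hist_gen_measurable|exact: mP].
Qed.

End Filtration.

Section Events.
Context d {T : measurableType d} {R : realType} (Pr : probability T R).
Variables (n r m : nat) (f : 'cV[R]_n -> R).
Variables (P : nat -> T -> 'M[R]_(r, n)) (D : nat -> T -> 'I_m -> 'cV[R]_r).
Variables (x : nat -> T -> 'cV[R]_n) (eta sigma Pmax kappa Dmax p q : R).
Hypotheses (m_gt0 : (0 < m)%N) (r_gt0 : (0 < r)%N) (f_C1 : continuous (grad f)).
Hypotheses (sigma_gt0 : 0 < sigma) (Pmax_gt0 : 0 < Pmax).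
Hypotheses (kappa01 : 0 < kappa <= 1) (Dmax_gt1 : 1 < Dmax).
Hypotheses (mP : forall k, adapted (@measurable d T) (P k))
  (mD : forall k i, adapted (@measurable d T) (D k ^~ i))
  (x_hist : forall k, adapted (hist P D k) (x k)).

Definition good_iteration k w : bool :=
  `[< well_aligned eta sigma Pmax f (x k w) (P k w) /\
      descent_set kappa Dmax f (x k w) (P k w) (D k w) >].

Lemma well_aligned_hist_half k :
  hist_half P D k [set w | well_aligned eta sigma Pmax f (x k w) (P k w)].
Proof.
have xk : adapted (hist_half P D k) (x k).
  by move=> A /x_hist; exact: hist_sub_half.
apply: (@measurable_well_aligned _
  (g_sigma_algebraType (hist_gen P D k `|` preimages (P k)))) => //.
exact: adapted_P_half.
Qed.

Lemma good_iterationE k : [set w | good_iteration k w] =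
  [set w | well_aligned eta sigma Pmax f (x k w) (P k w)] `&`
  [set w | descent_set kappa Dmax f (x k w) (P k w) (D k w)].
Proof. by apply/seteqP; split => w /asboolP. Qed.

Lemma good_iteration_hist k : hist P D k.+1 [set w | good_iteration k w].
Proof.
have xk : adapted (hist P D k.+1) (x k).
  by move=> A /x_hist; exact: hist_le (leqnSn k) _.
rewrite good_iterationE.
apply: (@measurableI _ (g_sigma_algebraType (hist_gen P D k.+1))).
  by apply: measurable_well_aligned => //; exact: adapted_P.
apply: measurable_descent_set => //; first exact: adapted_P.
by move=> i; exact: adapted_D.
Qed.

Lemma good_count_hist k j : hist P D k [set w | count_upto good_iteration k w = j].
Proof.
apply: (@measurable_count_level _ (g_sigma_algebraType (hist_gen P D k))) => i ik.
by apply: (hist_le ik); exact: good_iteration_hist.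
Qed.

(** Tower property: condition on [P k] before [D k]. *)
Lemma good_iteration_prob k B :
  0 <= p -> 0 <= q ->
  well_aligned_seq Pr eta sigma Pmax q f x P D ->
  descent_seq Pr kappa Dmax p f x P D -> hist P D k B ->
  ((p * q)%:E * Pr B <= Pr ([set w | good_iteration k w] `&` B))%E.
Proof.
move=> p0 q0 hP hD hB.
have hW := cond_prob_ge_le (hist_measurable mP mD (k := k)) q0 (hP k) hB.
have hWB : hist_half P D k
    ([set w | well_aligned eta sigma Pmax f (x k w) (P k w)] `&` B).
  apply: (@measurableI _ (g_sigma_algebraType (hist_gen P D k `|` preimages (P k)))).
    exact: well_aligned_hist_half.
  exact: hist_sub_half.
have hV := cond_prob_ge_le (hist_half_measurable mP mD (k := k)) p0 (hD k) hWB.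
rewrite good_iterationE [X in Pr (X `&` B)]setIC -setIA; apply: le_trans hV.
by rewrite EFinM -muleA lee_wpmul2l ?lee_fin.
Qed.

End Events.

Section Evaluations.
Context d {T : measurableType d} {R : realType} (n m : nat).
Variables (f : 'cV[R]_n -> R) (x : nat -> T -> 'cV[R]_n).
Variables (E : nat -> T -> {set 'I_m}) (eps : R).

(** The numbers of evaluations are integers, so their infimum is attained. *)
Lemma Neval_leP (y : nat -> 'cV[R]_n) (F : nat -> {set 'I_m}) (N : nat) :
  (Neval f y F eps <= N%:R%:E)%E <->
  exists2 k, enorm (grad f (y k)) <= eps & (1 + \sum_(j < k) #|F j| <= N)%N.
Proof.
split; last first.
  move=> [k hk hN]; apply: (@le_trans _ _ ((1 + \sum_(j < k) #|F j|)%N%:R)%:E).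
    by apply: ereal_inf_lbound; exists k.
  by rewrite lee_fin ler_nat.
move=> le_N; have : (Neval f y F eps < N.+1%:R%:E)%E.
  by apply: le_lt_trans le_N _; rewrite lte_fin ltr_nat.
move=> /ereal_inf_lt[_ [k hk <-]]; rewrite lte_fin ltr_nat ltnS => hN.
by exists k.
Qed.

Lemma measurable_Neval_le (N : nat) :
  continuous (grad f) ->
  (forall k, adapted (@measurable d T) (x k)) ->
  (forall k A, measurable [set w | E k w = A]) ->
  measurable [set w | (Neval f (x ^~ w) (E ^~ w) eps <= N%:R%:E)%E].
Proof.
move=> f_C1 mx mE.
rewrite [X in measurable X](_ : _ = \bigcup_k
   ([set w | enorm (grad f (x k w)) <= eps] `&`
    [set w | 1 + \sum_(j < k) (#|E j w|)%:R <= (N%:R : R)])); last first.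
  apply/seteqP; split => w /=.
    move=> /Neval_leP[k hk hN]; exists k => //; split => //=.
    by rewrite -natr_sum nat1r ler_nat.
  move=> [k _ [hk /= hN]]; apply/Neval_leP; exists k => //.
  by move: hN; rewrite -natr_sum nat1r ler_nat.
apply: bigcup_measurable => k _; apply: measurableI.
  by apply: measurable_le => //; exact: (measurable_enorm_grad f_C1 (@mx k)).
apply: measurable_le => //.
apply: (@measurable_funD _ _ _ _ (cst 1)); first exact: measurable_cst.
apply: measurable_sum => j _ Y _; rewrite setTI (_ : _ @^-1` _ =
  \bigcup_(A in [set A : {set 'I_m} | Y (#|A|)%:R]) [set w | E j w = A]).
  by apply: fin_bigcup_measurable => //; exact: finite_finset.
by apply/seteqP; split => w /=; [move=> h; exists (E j w)|move=> [A hA /= ->]].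
Qed.

End Evaluations.

Theorem corollary3p1 (R : realType) (d : measure_display) (T : measurableType d)
    (Pr : probability T R) (n r m : nat)
    (hm : (1 <= m)%N) (hr : (1 <= r <= n)%N)
    (f : 'cV[R]_n -> R) (L flow : R)
    (f_diff : forall x, differentiable f x)
    (f_C1 : continuous (grad f))
    (hL : 0 < L)
    (f_lip : forall x y, enorm (grad f x - grad f y) <= L * enorm (x - y))
    (f_low : forall x, flow <= f x)
    (x0 : 'cV[R]_n) (alphamax alpha0 c gdec ginc : R)
    (halphamax : 0 < alphamax) (halpha0 : 0 < alpha0 <= alphamax) (hc : 0 < c)
    (hgdec : 0 < gdec < 1) (hginc : 1 < ginc)
    (P : nat -> T -> 'M[R]_(r, n)) (D : nat -> T -> 'I_m -> 'cV[R]_r)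
    (x : nat -> T -> 'cV[R]_n) (alpha : nat -> T -> R)
    (E : nat -> T -> {set 'I_m})
    (halg : random_direct_search f x0 alpha0 alphamax c gdec ginc P D x alpha E)
    (eta sigma Pmax kappa Dmax p q : R)
    (heta : 0 < eta) (hsigma : 0 < sigma) (hPmax : 0 < Pmax)
    (hkappa : 0 < kappa <= 1) (hDmax : 1 < Dmax)
    (hp : 0 < p <= 1) (hq : 0 < q <= 1)
    (hD : descent_seq Pr kappa Dmax p f x P D)
    (hP : well_aligned_seq Pr eta sigma Pmax q f x P D)
    (eps : R) :
  let abar := 2 * kappa * eta / ((L + c) * Pmax ^+ 2 * Dmax ^+ 3) in
  let beta := 2 * Dmax ^+ 2 * (f x0 - flow) / (c * sigma ^+ 2) in
  let mu := logb ginc gdec^-1 in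
  let C := (mu * gdec ^+ 2 + ginc ^+ 2) * ginc ^+ 2 * beta / (mu * gdec ^+ 4) in
  let p0 := Order.max (1 / (1 + mu)) (mu / (1 + mu)) in
  let phi := (1 - p0) * C / abar ^+ 2 * eps ^- 2
             + (1 - p0) * logb gdec (gdec ^+ 2 * abar / (ginc * alpha0) * eps) in
  p0 < p * q ->
  0 < eps <= Order.min 1 (ginc^-1 * alpha0 / abar) ->
  ((1 - expR (- ((p * q - p0) / (4 * (p * q)) * phi)))%:E <=
   Pr [set w | (Neval f (x ^~ w) (E ^~ w) eps <=
                ((Num.ceil (2 * m%:R / (p * q - p0) * phi))%:~R)%:E)%E])%E.
Proof.
move=> abar beta mu C p0 phi p0_lt /andP[eps_gt0].
rewrite le_min => /andP[_ eps_le].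
have [mP mD x_hist E_hist run] := halg.
have /andP[r_gt0 _] := hr.
have [/andP[p_gt0 _] /andP[q_gt0 _]] := (hp, hq).
have p0_gt0 : 0 < p0.
  have mu_gt0 : 0 < mu.
    have /andP[g0 g1] := hgdec.
    by rewrite divr_gt0 ?ln_gt0 // invf_gt1.
  by rewrite lt_max divr_gt0 // addr_gt0.
have pq_gt0 : 0 < p * q by rewrite mulr_gt0.
set delta := p * q - p0; have delta_gt0 : 0 < delta by rewrite subr_gt0.
have [phi_le0|phi_gt0] := leP phi 0.
  apply: (@le_trans _ _ 0%E); last exact: measure_ge0.
  rewrite lee_fin subr_le0 -[leLHS]expR0 ler_expR oppr_ge0.
  by rewrite mulr_ge0_le0 // divr_ge0 // ltW // mulr_gt0.
have m_gt0 : 0 < m%:R :> R by rewrite ltr0n.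
set budget := 2 * m%:R / delta * phi.
have budget_gt0 : 0 < budget by rewrite mulr_gt0 // divr_gt0 // mulr_gt0.
have ceil_gt0 : 0 < Num.ceil budget by rewrite ceil_gt0.
have [N NE] : exists N : nat, Num.ceil budget = N%:Z.
  by exists `|Num.ceil budget|%N; rewrite gez0_abs // ltW.
rewrite NE.
have N_gt0 : (0 < N)%N by move: ceil_gt0; rewrite NE.
have budget_le : budget <= N%:R by have := ceil_ge budget; rewrite NE.
(* K is the ceiling of N / m: an iterate j < K is reached after at most
   1 + j * m <= N evaluations, the 1 being for x0. *)
pose K := (N.-1 %/ m).+1.
have N_le : (N <= K * m)%N.
  by rewrite -(prednK N_gt0) /K ltn_ceil.
have K_ge : 2 / delta * phi <= K%:R.
  rewrite -(ler_pM2r m_gt0) -natrM; apply: le_trans (_ : N%:R <= _).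
    apply: le_trans budget_le; rewrite /budget le_eqVlt; apply/orP; left.
    by apply/eqP; ring.
  by rewrite ler_nat.
set S := [set w | _].
have mS : measurable S.
  apply: measurable_Neval_le => // [k|k A].
    by move=> B /x_hist; exact: hist_measurable.
  by apply: (hist_measurable mP mD); exact: E_hist.
pose Z := good_iteration f P D x eta sigma Pmax kappa Dmax.
(* The midpoint of p0 and p * q: half of the gap absorbs phi, which is at most
   delta / 2 * K, and the other half is left to the Chernoff bound. *)
pose lam := p0 + delta / 2.
have few_good : ~` S `<=` [set w | (count_upto Z K w)%:R <= lam * K%:R].
  move=> w /= notS.
  have large j : (j < K)%N -> eps < enorm (grad f (x j w)).
    move=> jK; rewrite ltNge; apply/negP => hj; apply: notS.
    apply/Neval_leP; exists j => //.
    rewrite -(prednK N_gt0) ltnS.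
    apply: (@leq_trans (j * m)); last first.
      by apply: leq_trans (leq_trunc_div _ m); rewrite leq_mul2r -ltnS jK orbT.
    rewrite -[j in leqRHS]card_ord -sum_nat_const; apply: leq_sum => i _.
    by rewrite -[leqRHS]card_ord max_card.
  have eps_ok : 0 < eps <= ginc^-1 * alpha0 / abar by rewrite eps_gt0.
  have count_le : (count_upto Z K w)%:R <= p0 * K%:R + phi.
    rewrite /count_upto natr_sum.
    exact: (good_iterations_le hm r_gt0 f_diff hL f_lip f_low halpha0 hc hgdec
      hginc heta hsigma hPmax hkappa hDmax (run w) eps_ok large).
  apply: (le_trans count_le); rewrite mulrDl lerD2l.
  have : delta / 2 * (2 / delta * phi) <= delta / 2 * K%:R.
    by rewrite ler_wpM2l // divr_ge0 // ltW.
  by rewrite mulrA [_ / _ * _](_ : _ = 1) ?mul1r //; field; rewrite gt_eqF.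
have mZ k : measurable [set w | Z k w].
  by apply: (hist_measurable mP mD); exact: good_iteration_hist.
have Z_ge k j : ((p * q)%:E * Pr [set w | count_upto Z k w = j] <=
    Pr ([set w | Z k w] `&` [set w | count_upto Z k w = j]))%E.
  apply: good_iteration_prob => //; [exact: ltW|exact: ltW|].
  exact: good_count_hist.
have lam_ge0 : 0 <= lam by rewrite addr_ge0 ?(ltW p0_gt0) // divr_ge0 // ltW.
have pq_lam : p * q - lam = delta / 2 by rewrite /lam /delta; field.
have lam_le : lam <= p * q by rewrite -subr_ge0 pq_lam divr_ge0 // ltW.
have tail := chernoff_count pq_gt0 mZ Z_ge K lam_ge0 lam_le.
have mC : measurable [set w | (count_upto Z K w)%:R <= lam * K%:R].
  rewrite [X in measurable X](_ : _ = \bigcup_(j in [set j : nat | j%:R <= lam * K%:R])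
    [set w | count_upto Z K w = j]).
    by apply: bigcup_measurable => j _; exact: measurable_count_level.
  by apply/seteqP; split => w /=; [move=> h; exists (count_upto Z K w)|move=> [j h /= ->]].
have notS_le : (Pr (~` S) <= (expR (- (delta / (4 * (p * q)) * phi)))%:E)%E.
  apply: (@le_trans _ _ (Pr [set w | (count_upto Z K w)%:R <= lam * K%:R])).
    by apply: le_measure => //; rewrite inE //; exact: measurableC.
  apply: le_trans tail _; rewrite lee_fin ler_expR pq_lam mulNr lerN2.
  have -> : delta / (4 * (p * q)) * phi =
      (delta / 2) ^+ 2 / (2 * (p * q)) * (2 / delta * phi).
    by field; rewrite !gt_eqF.
  by rewrite ler_wpM2l // divr_ge0 ?sqr_ge0 // mulr_ge0 // ltW.
rewrite -[S]setCK probability_setC; last exact: measurableC.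
by rewrite EFinB leeB.
Qed.
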